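(* Let $\mathcal{S}$ be the algebra of symmetric functions, $\mathcal{D}\subseteq\mathcal{S}$ the subalgebra of doubly symmetric functions, and $\mathcal{I}\subseteq\mathcal{S}$ the ideal generated by all differences $S_\lambda-S_{\lambda'}$, $\lambda$ a partition. Then $\mathcal{D}$ and $\mathcal{I}$ are orthogonal complements with respect to the inner product $\langle\cdot,\cdot\rangle$ on $\mathcal{S}$; that is, $\mathcal{D}=\{f\in\mathcal{S} : \langle f,g\rangle=0 \text{ for all } g\in\mathcal{I}\}$ and $\mathcal{S}=\mathcal{D}\oplus\mathcal{I}$.
   Context: $\mathcal{S}$ is the algebra of symmetric functions over $\mathbb{Q}$, with basis the Schur functions $S_\lambda$ indexed by all partitions $\lambda$ (including the empty one); $\lambda'$ is the conjugate partition. The inner product $\langle\cdot,\cdot\rangle$ on $\mathcal{S}$ is the standard (Hall) one, for which the Schur functions are orthonormal. Hook Schur functions: for finite, possibly empty, lists of variables $X=(x_1,\ldots,x_k)$, $Y=(y_1,\ldots,y_\ell)$, a $(k,\ell)$-semistandard tableau of shape $\lambda$ is a filling of the Young diagram of $\lambda$ with entries from the ordered alphabet $1<2<\cdots<k<1'<\cdots<\ell'$ such that entries are non-decreasing in each row and each column, unprimed symbols may repeat in rows but not in columns, and primed symbols may repeat in columns but not in rows. Then $HS_\lambda(X;Y)=\sum_T x^T$, summed over all such tableaux $T$, where $x^T=\prod_j x_j^{\#\{j \text{ in } T\}}\prod_j y_j^{\#\{j'\text{ in }T\}}$. A symmetric function $\sum_\lambda m_\lambda S_\lambda$ is doubly symmetric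 if for all finite (possibly empty) sets of variables $X,Y$ one has $\sum_\lambda m_\lambda S_\lambda(X,Y)=\sum_\lambda m_\lambda HS_\lambda(X;Y)$, where $S_\lambda(X,Y)$ is the Schur polynomial in all the variables of $X$ and $Y$ together. $\mathcal{D}$ is the set of all doubly symmetric functions. *)

(* Defs.v *)
From HB Require Import structures.
From mathcomp Require Import all_boot all_order all_algebra.
From mathcomp.multinomials Require Import freeg mpoly.
From Stdlib Require Import ClassicalEpsilon.

Set Implicit Arguments.
Unset Strict Implicit.
Unset Printing Implicit Defensive.

Import GRing.Theory.
Local Open Scope ring_scope.

Definition is_part (s : seq nat) : bool := sorted geq s && (0%N \notin s).

Record intpart := IntPart { parts :> seq nat; _ : is_part parts }.

HB.instance Definition _ := [isSub for parts].
HB.instance Definition _ := [Countable of intpart by <:].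

(* Column lengths, read from left to right. *)
Definition conj_parts (s : seq nat) : seq nat :=
  [seq count (fun r => j < r)%N s | j <- iota 0 (head 0%N s)].

Lemma conj_parts_is_part s : is_part (conj_parts s).
Proof.
apply/andP; split.
  apply: homo_sorted (iota_ltn_sorted 0 (head 0%N s)) => i j lt_ij.
  by apply: sub_count => r /=; apply: ltn_trans.
apply/mapP => -[j]; rewrite mem_iota /= => lt_j.
by case: s lt_j => //= r s ->.
Qed.

Definition conj_part (la : intpart) : intpart :=
  IntPart (conj_parts_is_part la).

Section Tableaux.
Variable la : intpart.

(* Cells of the Young diagram in English notation; rows and columns are
   numbered from 0. *)
Definition cell := {i : 'I_(size la) & 'I_(nth 0%N la i)}.
Definition cell_row (c : cell) : nat := tag c.
Definition cell_col (c : cell) : nat := tagged c.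

Definition left_of (c d : cell) : bool :=
  (cell_row c == cell_row d) && (cell_col c < cell_col d)%N.
Definition above (c d : cell) : bool :=
  (cell_col c == cell_col d) && (cell_row c < cell_row d)%N.

Definition filling (n : nat) := {ffun cell -> 'I_n}.

Definition filling_monomial n (T : filling n) : {mpoly rat[n]} :=
  \prod_(c : cell) 'X_(T c).

Definition semistandard n (T : filling n) : bool :=
  [forall c, forall d,
    (left_of c d ==> (T c <= T d)%N) && (above c d ==> (T c < T d)%N)].

(* The letter a < k of 'I_(k + l) is the unprimed symbol a + 1, and the
   letter k + b is the primed symbol (b + 1)'. *)
Definition hook_semistandard k l (T : filling (k + l)) : bool :=
  [forall c, forall d,
    (left_of c d ==> (T c <= T d)%N && ((T c == T d) ==> (T c < k)%N)) &&
    (above c d ==> (T c <= T d)%N && ((T c == T d) ==> (k <= T c)%N))].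

Definition schur_poly (n : nat) : {mpoly rat[n]} :=
  \sum_(T : filling n | semistandard T) filling_monomial T.

(* The first k variables are X, the last l are Y. *)
Definition hook_schur_poly (k l : nat) : {mpoly rat[k + l]} :=
  \sum_(T : filling (k + l) | hook_semistandard T) filling_monomial T.

End Tableaux.

(* A symmetric function in infinitely many variables is encoded by its
   restrictions f n to the first n variables.  The operations on symmetric
   functions are the pointwise ones. *)
Definition polyfam := forall n : nat, {mpoly rat[n]}.

Definition kill_last n (p : {mpoly rat[n.+1]}) : {mpoly rat[n]} :=
  p \mPo [tuple if unlift ord_max i is Some j then 'X_j else 0 | i < n.+1].

Definition symfun (f : polyfam) : Prop :=
  [/\ forall n, f n \is symmetric,
      forall n, kill_last (f n.+1) = f n
    & exists d : nat, forall n, (msize (f n) <= d)%N].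

Definition schur (la : intpart) : polyfam := fun n => schur_poly la n.

Definition schur_sum (m : {freeg intpart / rat}) : polyfam :=
  fun n => \sum_(la <- dom m) coeff la m *: schur la n.

Definition hook_schur_sum (m : {freeg intpart / rat}) (k l : nat) :
    {mpoly rat[k + l]} :=
  \sum_(la <- dom m) coeff la m *: hook_schur_poly la k l.

(* Meaningful on symmetric functions only, where the expansion in the Schur
   basis exists and is unique. *)
Definition schur_coords (f : polyfam) : {freeg intpart / rat} :=
  epsilon (inhabits 0) (fun m => f = schur_sum m).

(* The form on symmetric functions for which the schur la are orthonormal. *)
Definition hall (f g : polyfam) : rat :=
  \sum_(la <- dom (schur_coords f))
    coeff la (schur_coords f) * coeff la (schur_coords g).

Definition doubly_symmetric (f : polyfam) : Prop :=
  exists m : {freeg intpart / rat},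
    f = schur_sum m /\
    forall k l : nat, schur_sum m (k + l)%N = hook_schur_sum m k l.

(* The ideal of the algebra of symmetric functions generated by the
   differences schur la - schur (conj_part la). *)
Definition conj_ideal (f : polyfam) : Prop :=
  exists (r : nat) (a : 'I_r -> polyfam) (la : 'I_r -> intpart),
    (forall i, symfun (a i)) /\
    f = fun n =>
      \sum_(i < r) a i n * (schur (la i) n - schur (conj_part (la i)) n).

(* Main.v *)
Require Import Defs.
From HB Require Import structures.
From mathcomp Require Import all_boot all_order all_fingroup all_algebra.
From mathcomp.multinomials Require Import freeg mpoly.
From mathcomp Require Import zify ring.
From Stdlib Require Import ClassicalEpsilon FunctionalExtensionality.

(* Write <m, F> for the sum of m_la F(la), and K(w, la) for the number of chains
   of horizontal and vertical strips from the empty partition to la whose kinds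
   and sizes are prescribed by the word w.  Removing the cells that carry the
   largest letter shows that K gives the coefficients of the Schur and of the
   hook Schur polynomials, so that the sum of m_la S_la is doubly symmetric iff
   m is orthogonal to K(h_a h_b) - K(h_a e_b) for all a and b.  By Pieri's rules,
   the K(w, la) are also the Schur coordinates of the product of the h_k and e_k
   spelled by w.  Since these products of h_k span the symmetric functions, and
   since conjugating partitions exchanges the h_k and the e_k, the elements
   h_a (h_b - e_b) span the ideal; hence D is its orthogonal complement.  The
   direct sum decomposition then holds degree by degree, the form being positive
   definite. *)

Set Implicit Arguments.
Unset Strict Implicit.
Unset Printing Implicit Defensive.

Import GRing.Theory.
Local Open Scope ring_scope.

(** * Partitions and strips *)

(** Products are only ever formed by concatenating words; Schur functions are recovered from words
    through the inverse of the Kostka matrix, which is unitriangular for the statistic [rowstat].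
    The same triangularity carries the symmetry of the h_k over to the Schur polynomials and yields
    their linear independence; together with leading monomials it yields spanning. Three obstacles
    shape the rest. The e_k enter as Schur functions of columns, so their Pieri rule has to be
    deduced from that of the h_k, by an alternating sum over strips. In infinite dimension a
    subspace and its orthogonal complement need not span, so the decomposition is made below a
    weight bound; this suffices because the elements tested against are homogeneous. Finally,
    membership in the ideal is a bare existential statement, so the subspace to project on must
    first be given a finite basis. *)

Notation rowlen la i := (nth 0%N (parts la) i).

Lemma rowlen_anti (la : intpart) i j : (i <= j)%N -> (rowlen la j <= rowlen la i)%N.
Proof.
case: la => s /= /andP [s_sorted _] le_ij.
have [lt_js|/(nth_default 0%N) -> //] := ltnP j (size s).
have /(sorted_leq_nth (rev_trans leq_trans) leqnn) h := s_sorted.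
exact: (h 0%N i j (leq_ltn_trans le_ij lt_js) lt_js le_ij).
Qed.

Lemma rowlen_gt0 (la : intpart) i : (0 < rowlen la i)%N = (i < size la)%N.
Proof.
case: la => s /= /andP [_ s0].
have [lt_is|/(nth_default 0%N) -> //] := ltnP i (size s).
by rewrite lt0n; apply: contraNneq s0 => <-; apply: mem_nth.
Qed.

Lemma rowlen_eq0 (la : intpart) i : (size la <= i)%N -> rowlen la i = 0%N.
Proof. by move/(nth_default 0%N). Qed.

Lemma intpart_eqP (la mu : intpart) :
  (forall i, rowlen la i = rowlen mu i) -> la = mu.
Proof.
move=> eq_rowlen; apply: val_inj; apply: (@eq_from_nth _ 0%N) => //.
have le_size (nu xi : intpart) :
    (forall i, rowlen nu i = rowlen xi i) -> (size nu <= size xi)%N.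
  by move=> h; rewrite leqNgt -rowlen_gt0 h rowlen_gt0 ltnn.
by apply/eqP; rewrite eqn_leq !le_size.
Qed.

Lemma part0_proof : is_part [::]. Proof. by []. Qed.
Definition part0 : intpart := IntPart part0_proof.

Lemma rowlen_part0 i : rowlen part0 i = 0%N.
Proof. by rewrite nth_nil. Qed.

(** The bound [m] cuts the infinite sequence [f], which loses nothing once [f] is antitone with
    [f m = 0]. A list that is not a partition after its zeros are dropped falls back to [part0]. *)
Definition mkpart (f : nat -> nat) (m : nat) : intpart :=
  insubd part0 [seq y <- mkseq f m | y != 0%N].

Lemma rowlen_mkpart f m i :
  (forall j, (f j.+1 <= f j)%N) -> f m = 0%N -> rowlen (mkpart f m) i = f i.
Proof.
move=> f_anti fm.
have f_le j k : (j <= k)%N -> (f k <= f j)%N.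
  by move=> /subnK <-; elim: (k - j)%N => // d; apply: leq_trans (f_anti _).
have -> : parts (mkpart f m) = [seq y <- mkseq f m | y != 0%N].
  apply: (@insubdK _ _ intpart).
  rewrite -topredE /= /is_part mem_filter /= andbT; apply: sorted_filter.
    by move=> a b c /= h1 h2; apply: leq_trans h2 h1.
  apply: homo_sorted (iota_ltn_sorted 0 m) => a b /ltnW; exact: f_le.
elim: m i f f_anti f_le fm => [|m IH] i f f_anti f_le fm.
  by rewrite nth_nil; move: (f_le 0%N i isT); rewrite fm leqn0 => /eqP.
rewrite /mkseq -[iota _ _]/(0%N :: iota (1 + 0) m) iotaDl /= -map_comp.
case: eqP => [f0|nf0] /=.
  rewrite (eq_in_filter (a2 := pred0)) ?filter_pred0 ?nth_nil.
    by move: (f_le 0%N i isT); rewrite f0 leqn0 => /eqP.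
  move=> y /mapP [k _ ->] /=.
  by move: (f_le 0%N (1 + k)%N isT); rewrite f0 leqn0 => /eqP ->.
case: i => [|i] //=.
apply: (IH i (f \o addn 1)) => //= j k le_jk; apply: f_le.
by rewrite leq_add2l.
Qed.

Notation weight la := (sumn (parts la)).

Lemma weightE (la : intpart) m :
  (size la <= m)%N -> weight la = (\sum_(i < m) rowlen la i)%N.
Proof.
move=> le_m; rewrite sumnE (big_nth 0%N) -(big_mkord xpredT (fun i => rowlen la i)).
rewrite [in RHS](big_cat_nat _ (n := size la)) //=.
rewrite [X in (_ = _ + X)%N]big_nat_cond [X in (_ + X)%N]big1 ?addn0 // => i.
by case/andP => /andP [h _] _; apply: rowlen_eq0.
Qed.

Lemma rowlen_le_weight (la : intpart) i : (rowlen la i <= weight la)%N.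
Proof.
have [lt_i|/rowlen_eq0 -> //] := ltnP i (size la).
by rewrite (weightE (leqnn _)) (bigD1 (Ordinal lt_i)) //= leq_addr.
Qed.

Lemma weight_size (la : intpart) : (size la <= weight la)%N.
Proof.
rewrite (weightE (leqnn _)) -[X in (X <= _)%N]card_ord -sum1_card.
by apply: leq_sum => i _; rewrite rowlen_gt0.
Qed.

Lemma rowlen_le_weight0 (la : intpart) i : (weight la <= i)%N -> rowlen la i = 0%N.
Proof. by move=> h; apply/rowlen_eq0/(leq_trans (weight_size _)). Qed.

Lemma weight0 (la : intpart) : weight la = 0%N -> la = part0.
Proof.
move=> h; apply: intpart_eqP => i; rewrite rowlen_part0.
by apply: rowlen_le_weight0; rewrite h.
Qed.

Lemma weight_le (la mu : intpart) :
  (forall i, rowlen mu i <= rowlen la i)%N -> (weight mu <= weight la)%N.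
Proof.
move=> h; rewrite (@weightE la (size la + size mu)) ?leq_addr //.
rewrite (@weightE mu (size la + size mu)) ?leq_addl //.
exact: leq_sum.
Qed.

Lemma weight_lt_eq (la mu : intpart) :
  (forall i, rowlen mu i <= rowlen la i)%N -> weight mu = weight la -> mu = la.
Proof.
move=> h; rewrite (@weightE la (size la + size mu)) ?leq_addr //.
rewrite (@weightE mu (size la + size mu)) ?leq_addl // => hs.
apply: intpart_eqP => i.
have [lt_i|ge_i] := ltnP i (size la + size mu); last first.
  by rewrite !rowlen_eq0 //; apply: leq_trans ge_i; rewrite ?leq_addr ?leq_addl.
apply/eqP; rewrite eqn_leq h /= leqNgt; apply/negP => lt_mu.
have : (\sum_(i < size la + size mu) rowlen mu i <
        \sum_(i < size la + size mu) rowlen la i)%N.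
  rewrite (bigD1 (Ordinal lt_i)) //= [X in (_ < X)%N](bigD1 (Ordinal lt_i)) //=.
  by rewrite -addSn leq_add //; apply: leq_sum.
by rewrite hs ltnn.
Qed.

(** A partition of weight at most [D] has at most [D] rows, each of length at most [D], so these
    tuples reach all of them. Several tuples can give the same partition, whence [undup];
    duplicate-free lists allow sums to be compared by membership alone. *)
Definition ptsle (D : nat) : seq intpart :=
  [seq la <- undup [seq mkpart (fun i => nth 0%N [seq val x | x <- val t] i) D
                   | t <- enum {: D.-tuple 'I_D.+1}] | (weight la <= D)%N].

Definition pts (d : nat) : seq intpart :=
  [seq la <- ptsle d | weight la == d].

Lemma mem_ptsle D la : (la \in ptsle D) = (weight la <= D)%N.
Proof.
rewrite mem_filter; have [le_D|//] /= := leqP.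
rewrite mem_undup; apply/mapP.
pose t := [tuple inord (rowlen la i) : 'I_D.+1 | i < D].
exists t; first by rewrite mem_enum.
have rowt i : nth 0%N [seq val x | x <- val t] i = rowlen la i.
  have [lt_i|ge_i] := ltnP i D; last first.
    rewrite [RHS]rowlen_le_weight0; last exact: leq_trans ge_i.
    by rewrite nth_default // size_map size_tuple.
  rewrite (nth_map ord0) ?size_tuple // -[i]/(val (Ordinal lt_i)) -tnth_nth.
  by rewrite tnth_mktuple /= inordK // ltnS (leq_trans (rowlen_le_weight _ _)).
apply: intpart_eqP => i; rewrite rowlen_mkpart ?rowt // => [j|].
  by rewrite !rowt rowlen_anti.
by rewrite rowlen_le_weight0.
Qed.

Lemma mem_pts d la : (la \in pts d) = (weight la == d).
Proof. by rewrite mem_filter mem_ptsle; case: eqP => //= ->; rewrite leqnn. Qed.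

Lemma uniq_ptsle D : uniq (ptsle D).
Proof. by rewrite filter_uniq ?undup_uniq. Qed.

Lemma uniq_pts d : uniq (pts d).
Proof. by rewrite filter_uniq ?uniq_ptsle. Qed.

Lemma eq_big_uniq (R : Type) (idx : R) (op : Monoid.com_law idx)
    (T : eqType) (s t : seq T) (P Q : pred T) (F : T -> R) :
  uniq s -> uniq t -> (forall x, (x \in s) && P x = (x \in t) && Q x) ->
  \big[op/idx]_(x <- s | P x) F x = \big[op/idx]_(x <- t | Q x) F x.
Proof.
move=> us ut h; rewrite -big_filter -[RHS]big_filter; apply: perm_big.
apply: uniq_perm; rewrite ?filter_uniq // => x.
by rewrite !mem_filter andbC h andbC.
Qed.

Arguments eq_big_uniq {R idx op T s} t {P} Q {F}.

(* [strip false] is a horizontal strip, [strip true] a vertical one. *)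
Definition strip (b : bool) (mu la : intpart) : bool :=
  [forall i : 'I_(size la + size mu), (rowlen mu i <= rowlen la i)%N &&
     (if b then rowlen la i <= (rowlen mu i).+1 else rowlen la i.+1 <= rowlen mu i)%N].

Lemma stripP b mu la :
  reflect (forall i, (rowlen mu i <= rowlen la i)%N /\
     (if b then rowlen la i <= (rowlen mu i).+1 else rowlen la i.+1 <= rowlen mu i)%N)
    (strip b mu la).
Proof.
apply: (iffP forallP) => [h i|h i]; last by apply/andP; apply: h.
have [lt_i|ge_i] := ltnP i (size la + size mu).
  by apply/andP; apply: (h (Ordinal lt_i)).
rewrite !rowlen_eq0 //; first by case: b h.
- by apply: leq_trans (leqW ge_i); rewrite leq_addr.
- by apply: leq_trans ge_i; rewrite leq_addr.
- by apply: leq_trans ge_i; rewrite leq_addl.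
Qed.

Lemma strip_rowlen b mu la : strip b mu la -> forall i, (rowlen mu i <= rowlen la i)%N.
Proof. by move=> /stripP h i; case: (h i). Qed.

Lemma strip_weight b mu la : strip b mu la -> (weight mu <= weight la)%N.
Proof. by move/strip_rowlen/weight_le. Qed.

Lemma strip_refl b mu : strip b mu mu.
Proof.
by apply/stripP => i; case: b; split=> //; apply: rowlen_anti.
Qed.

Lemma eq_count_bij (T U : eqType) (s : seq T) (t : seq U)
    (P : pred T) (Q : pred U)
    (f : T -> U) (g : U -> T) :
  uniq s -> uniq t ->
  (forall x, x \in s -> P x -> [/\ f x \in t, Q (f x) & g (f x) = x]) ->
  (forall y, y \in t -> Q y -> [/\ g y \in s, P (g y) & f (g y) = y]) ->
  count P s = count Q t.
Proof.
move=> us ut hf hg; rewrite -!size_filter -(size_map f).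
apply: perm_size; apply: uniq_perm; rewrite ?filter_uniq //.
  rewrite map_inj_in_uniq ?filter_uniq // => x y.
  rewrite !mem_filter => /andP [Px xs] /andP [Py ys] eq_f.
  by case: (hf x xs Px) (hf y ys Py) => _ _ <- [_ _ <-]; rewrite eq_f.
move=> y; apply/mapP/idP => [[x]|].
  rewrite !mem_filter => /andP [Px xs] ->.
  by case: (hf x xs Px) => -> ->.
rewrite mem_filter => /andP [Qy yt]; case: (hg y yt Qy) => gs Pg fg.
by exists (g y); rewrite ?mem_filter ?Pg ?gs.
Qed.

(* The switch between the partitions above and below a pair of partitions in
   the interlacing order: [la] and [rho] are determined by each other through
   [la_(i+1) + rho_i = min (mu_i, nu_i) + max (mu_(i+1), nu_(i+1))]. *)
Lemma count_interlacing (mu nu : intpart) (k : nat) :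
  count (fun la => strip false mu la && strip false nu la)
    (pts (weight mu + k)) =
  count (fun rho => [&& strip false rho mu, strip false rho nu
                      & (weight nu <= weight rho + k)%N])
    (ptsle (weight mu)).
Proof.
pose mid i := (minn (rowlen mu i) (rowlen nu i) +
               maxn (rowlen mu i.+1) (rowlen nu i.+1))%N.
pose m := (size mu + size nu + (weight mu + k))%N.
have m_mu : (size mu <= m)%N by rewrite /m -addnA leq_addr.
have m_nu : (size nu <= m)%N by rewrite /m addnAC leq_addl.
have mid_m i : (m <= i)%N -> mid i = 0%N.
  by move=> le_mi; rewrite /mid !rowlen_eq0 //; lia.
(* Minimum and maximum of a row of [mu] and [nu] add up to the two row lengths; the sum of the [mid]
   misses only the maximum in row 0. This relates the weights of [la] and [rho]. *)
have sum_mid : (maxn (rowlen mu 0) (rowlen nu 0) + \sum_(i < m) mid i)%N =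
    (weight mu + weight nu)%N.
  rewrite (@weightE mu m.+1) ?(@weightE nu m.+1) ?leqW //.
  rewrite -big_split /= [RHS](eq_bigr (fun i : 'I_m.+1 =>
    maxn (rowlen mu i) (rowlen nu i) + minn (rowlen mu i) (rowlen nu i)))%N;
    last by move=> i _; lia.
  rewrite [RHS]big_split /= [X in (_ = X + _)%N]big_ord_recl.
  rewrite [X in (_ = _ + X)%N]big_ord_recr /= !(@rowlen_eq0 _ m) // min0n addn0.
  rewrite -addnA; congr (_ + _)%N; rewrite -big_split /=.
  by apply: eq_bigr => i _; rewrite /mid addnC.
(* Row 0 of [la] is paired with no row of [rho]; the prescribed weight [weight mu + k] forces its
   length. The bound on [weight nu] in the second count says that this length is at least
   [maxn (rowlen mu 0) (rowlen nu 0)], so the subtraction does not truncate. *)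
pose up (rho : intpart) := mkpart (fun i => if i is j.+1 then mid j - rowlen rho j
  else maxn (rowlen mu 0) (rowlen nu 0) + (weight rho + k - weight nu))%N m.+1.
pose down (la : intpart) := mkpart (fun i => mid i - rowlen la i.+1)%N m.
have down_row la : strip false mu la -> strip false nu la ->
    forall i, rowlen (down la) i = (mid i - rowlen la i.+1)%N.
  move=> /stripP hm /stripP hn i; rewrite rowlen_mkpart //; last by rewrite mid_m.
  move=> j; have := hm j; have := hn j; have := hm j.+1; have := hn j.+1.
  have := hm j.+2; have := hn j.+2; rewrite /mid; lia.
have up_row rho : strip false rho mu -> strip false rho nu ->
    forall i, rowlen (up rho) i = (if i is j.+1 then mid j - rowlen rho j
  else maxn (rowlen mu 0) (rowlen nu 0) + (weight rho + k - weight nu))%N.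
  move=> /stripP hm /stripP hn i; rewrite rowlen_mkpart //; last by rewrite mid_m.
  move=> [|j].
    by have := hm 0%N; have := hn 0%N; rewrite /mid; lia.
  have := hm j; have := hn j; have := hm j.+1; have := hn j.+1.
  by rewrite /mid; lia.
have sum_split (rho la : intpart) :
    (forall i, rowlen rho i + rowlen la i.+1 = mid i)%N ->
    (size la <= m.+1)%N -> (size rho <= m)%N ->
    (weight rho + weight la = rowlen la 0 + \sum_(i < m) mid i)%N.
  move=> h la_m rho_m; rewrite (weightE rho_m) (weightE la_m).
  rewrite big_ord_recl addnCA -big_split /=; congr (_ + _)%N.
  by apply: eq_bigr => i _; apply: h.
apply: (eq_count_bij (f := down) (g := up)); rewrite ?uniq_pts ?uniq_ptsle //.
  move=> la; rewrite mem_pts => /eqP wla /andP [hm hn].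
  have dr := down_row la hm hn.
  have rel i : (rowlen (down la) i + rowlen la i.+1 = mid i)%N.
    rewrite dr; move/stripP: hm => hm; move/stripP: hn => hn.
    by have := hm i; have := hn i; have := hm i.+1; have := hn i.+1; rewrite /mid; lia.
  have dm : strip false (down la) mu.
    apply/stripP => i; have := rel i; move/stripP: hm => hm; move/stripP: hn => hn.
    by have := hm i; have := hn i; have := hm i.+1; have := hn i.+1; rewrite /mid; lia.
  have dn : strip false (down la) nu.
    apply/stripP => i; have := rel i; move/stripP: hm => hm; move/stripP: hn => hn.
    by have := hm i; have := hn i; have := hm i.+1; have := hn i.+1; rewrite /mid; lia.
  have la_m : (size la <= m)%N by rewrite (leq_trans (weight_size _)) // wla leq_addl.
  have d_m : (size (down la) <= m)%N.
    by have := weight_size (down la); have := strip_weight dm; rewrite /m; lia.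
  have hs := sum_split (down la) la rel (leqW la_m) d_m.
  have la0 : (maxn (rowlen mu 0) (rowlen nu 0) <= rowlen la 0)%N.
    by rewrite geq_max !(strip_rowlen hm, strip_rowlen hn).
  split.
  - by rewrite mem_ptsle (strip_weight dm).
  - by rewrite dm dn /=; lia.
  - apply: intpart_eqP => i; rewrite up_row //; case: i => [|i]; first by lia.
    by have := rel i; lia.
move=> rho _ /and3P [hm hn le_nu].
have ur := up_row rho hm hn.
have rel i : (rowlen rho i + rowlen (up rho) i.+1 = mid i)%N.
  rewrite ur; move/stripP: hm => hm; move/stripP: hn => hn.
  by have := hm i; have := hn i; rewrite /mid; lia.
have um : strip false mu (up rho).
  apply/stripP => i; have := rel i; rewrite [rowlen (up rho) i]ur.
  move/stripP: hm => hm; move/stripP: hn => hn.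
  case: i => [|i].
    by have := hm 0%N; have := hn 0%N; rewrite /mid; lia.
  by have := hm i; have := hn i; have := hm i.+1; have := hn i.+1; rewrite /mid; lia.
have un : strip false nu (up rho).
  apply/stripP => i; have := rel i; rewrite [rowlen (up rho) i]ur.
  move/stripP: hm => hm; move/stripP: hn => hn.
  case: i => [|i].
    by have := hm 0%N; have := hn 0%N; rewrite /mid; lia.
  by have := hm i; have := hn i; have := hm i.+1; have := hn i.+1; rewrite /mid; lia.
have rho_m : (size rho <= m)%N.
  by have := weight_size rho; have := strip_weight hm; rewrite /m; lia.
have up_m : (size (up rho) <= m.+1)%N.
  rewrite leqNgt -rowlen_gt0 ur -leqNgt leqn0.
  by rewrite mid_m.
have := sum_split rho (up rho) rel up_m rho_m; rewrite ur => hs.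
split.
- by rewrite mem_pts; lia.
- by rewrite um un.
- apply: intpart_eqP => i; rewrite down_row //.
  by have := rel i; lia.
Qed.

(** * Pieri's rules *)

Section Branching.
Variable R : comNzRingType.
Implicit Types (w : seq (bool * R)) (v : seq R) (la mu nu : intpart).

(* The head of the word is the largest letter; its flag tells whether it is
   primed. *)
Fixpoint super_schur w la : R :=
  if w is (b, x) :: w' then
    \sum_(mu <- ptsle (weight la) | strip b mu la)
      x ^+ (weight la - weight mu) * super_schur w' mu
  else (la == part0)%:R.

Definition seq_schur v la := super_schur [seq (false, x) | x <- v] la.

Lemma seq_schur_cons x v la : seq_schur (x :: v) la =
  \sum_(mu <- ptsle (weight la) | strip false mu la)
      x ^+ (weight la - weight mu) * seq_schur v mu.
Proof. by []. Qed.

Fixpoint complete v (k : nat) : R :=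
  if v is x :: v' then \sum_(j < k.+1) x ^+ j * complete v' (k - j)
  else (k == 0)%:R.

(** The column of [k] cells is the only vertical strip of size [k] on the empty partition, so this
    is its Schur polynomial. Writing it as a sum over strips makes e_k the case [mu = part0] of the
    right-hand side of Pieri's rule. *)
Definition elementary v (k : nat) : R :=
  \sum_(la <- pts k | strip true part0 la) seq_schur v la.

Lemma strip_part0 b mu : strip b mu part0 = (mu == part0).
Proof.
apply/idP/eqP => [h|->]; last exact: strip_refl.
apply: intpart_eqP => i; have := strip_rowlen h i.
by rewrite rowlen_part0 leqn0 => /eqP.
Qed.

Lemma super_schur_part0 w : super_schur w part0 = 1.
Proof.
elim: w => [|[b x] w IH] //=.
rewrite (eq_big_uniq [:: part0] xpredT) ?uniq_ptsle // => [|mu].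
  by rewrite big_seq1 /= subnn mul1r.
rewrite mem_ptsle strip_part0 inE andbT andbC.
by case: eqP => // ->.
Qed.

(** Induction on the variables. Splitting off [x] on the right gives, for each [nu], the number of
    [la] above both [mu] and [nu]; splitting it off both factors on the left and using induction
    gives the number of [rho] below both. [count_interlacing] equates the two, the power of [x]
    being fixed by the weight of [nu]. *)
Lemma pieri_complete v k mu :
  complete v k * seq_schur v mu =
  \sum_(la <- pts (weight mu + k) | strip false mu la) seq_schur v la.
Proof.
elim: v k mu => [|x v IH] k mu.
  rewrite /seq_schur /= -natrM mulnb.
  case: andP => [[/eqP -> /eqP ->]|h].
    rewrite (eq_big_uniq [:: part0] xpredT) ?uniq_pts //.
      by rewrite big_seq1 eqxx.
    move=> la; rewrite mem_pts inE andbT.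
    by apply/andP/eqP => [[/eqP/weight0]|->] //; rewrite strip_refl.
  rewrite big_seq_cond big1 // => la /andP [+ st]; rewrite mem_pts => wla.
  case: eqP => // la0; case: h; move: st wla; rewrite la0 strip_part0.
  by move=> /eqP -> /=; rewrite eq_sym.
pose G nu := x ^+ (weight mu + k - weight nu) * seq_schur v nu.
set D := (weight mu + k)%N.
transitivity (\sum_(nu <- ptsle D) \sum_(la <- pts D |
    strip false mu la && strip false nu la) G nu); last first.
  rewrite (exchange_big_dep (strip false mu)) /= => [|nu la _ /andP [] //].
  rewrite [LHS]big_seq_cond [RHS]big_seq_cond.
  apply: eq_bigr => la; rewrite mem_pts => /andP [/eqP wla st].
  by rewrite seq_schur_cons wla; apply: eq_bigl => nu; rewrite st.
transitivity (\sum_(nu <- ptsle D) \sum_(rho <- ptsle (weight mu) |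
    [&& strip false rho mu, strip false rho nu
      & (weight nu <= weight rho + k)%N]) G nu); last first.
  by apply: eq_bigr => nu _; rewrite !big_const_seq count_interlacing.
rewrite (exchange_big_dep (fun rho => strip false rho mu)) => [|nu rho _ /and3P [] //].
rewrite seq_schur_cons mulr_sumr; apply: eq_bigr => rho st.
have wr := strip_weight st; rewrite st /= mulr_suml.
transitivity (\sum_(j < k.+1) \sum_(nu <- ptsle D | strip false rho nu &&
    (weight nu == weight rho + (k - j))%N) G nu).
  apply: eq_bigr => j _; rewrite mulrACA -exprD IH mulr_sumr.
  rewrite (eq_big_uniq (ptsle D) (fun nu => strip false rho nu &&
    (weight nu == weight rho + (k - j))%N)) ?uniq_pts ?uniq_ptsle // => [|nu].
    apply: eq_bigr => nu /andP [_ /eqP wnu]; congr (_ ^+ _ * _).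
    by have := ltn_ord j; rewrite wnu /D; lia.
  rewrite mem_pts mem_ptsle; case: (strip false rho nu); rewrite ?andbF //=.
  by rewrite andbT; apply/idP/andP => [|[]]; rewrite /D; lia.
rewrite (exchange_big_dep (strip false rho)) /= => [|j nu _ /andP [] //].
rewrite [RHS]big_mkcondr; apply: eq_bigr => nu st'; have wn := strip_weight st'.
case: leqP => h; last first.
  by rewrite big1 // => j; rewrite st' /= => /eqP; have := ltn_ord j; lia.
have lt_j : (weight rho + k - weight nu < k.+1)%N by lia.
rewrite (big_pred1 (Ordinal lt_j)) // => j /=; rewrite st' /=.
by apply/eqP/eqP => [|-> /=]; [move=> hj; apply: val_inj => /=|];
  have := ltn_ord j; lia.
Qed.

(* Pieri's rules make this the relation [sum_i (-1)^i h_i e_(n-i) = 0]; the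
   involution moves the end of the last row in which [la] and [nu] differ. *)
Lemma sum_sign_strips (nu la : intpart) : nu != la ->
  \sum_(ka <- ptsle (weight la) | strip true nu ka && strip false ka la)
    (-1) ^+ weight ka = 0 :> int.
Proof.
move=> neq; set s := [seq ka <- ptsle (weight la) |
  strip true nu ka && strip false ka la].
have mem_s ka : (ka \in s) = strip true nu ka && strip false ka la.
  by rewrite mem_filter mem_ptsle; apply: andb_idr => /andP [_ /strip_weight].
rewrite -big_filter -/s.
have [s0|[ka0 ka0s]] : s = [::] \/ exists ka, ka \in s.
  by case: (s) => [|ka s']; [left | right; exists ka; rewrite mem_head].
  by rewrite s0 big_nil.
move: ka0s; rewrite mem_s => /andP [st1 st2].
have sub i : (rowlen nu i <= rowlen la i)%N.
  exact: leq_trans (strip_rowlen st1 i) (strip_rowlen st2 i).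
have [i0 lt_i0 eq_i] : exists2 i, (rowlen nu i < rowlen la i)%N &
    forall j, (i < j)%N -> rowlen nu j = rowlen la j.
  have exP : exists i, (rowlen nu i < rowlen la i)%N.
    have [i lt_i|h] := pickP (fun i : 'I_(size la) => rowlen nu i < rowlen la i)%N.
      by exists i.
    case/negP: neq; apply/eqP/intpart_eqP => i; apply/eqP; rewrite eqn_leq sub /=.
    have [lt_i|/rowlen_eq0 -> //] := ltnP i (size la).
    by have := h (Ordinal lt_i); rewrite ltnNge => /negbFE.
  have ubP i : (rowlen nu i < rowlen la i)%N -> (i <= size la)%N.
    by move/(leq_ltn_trans (leq0n _)); rewrite rowlen_gt0 => /ltnW.
  case: (ex_maxnP exP ubP) => i lt_i max_i; exists i => // j lt_ij.
  apply/eqP; rewrite eqn_leq sub leqNgt; apply: contraL lt_ij => /max_i.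
  by rewrite -leqNgt.
(* Row [i0] of a member of [s] has length [nu_i0] or [nu_i0 + 1], and [fl] exchanges the two. Both
   are admissible: [nu_i0 < la_i0], and [la_(i0+1) = nu_(i0+1) <= nu_i0] because the rows agree
   beyond [i0]. *)
pose fl (ka : intpart) i :=
  if i == i0 then ((rowlen nu i).*2.+1 - rowlen ka i)%N else rowlen ka i.
pose m := (size la).+1.
pose tg ka := mkpart (fl ka) m.
have stripsP ka : ka \in s -> forall i,
    [/\ rowlen nu i <= rowlen ka i, rowlen ka i <= (rowlen nu i).+1,
        rowlen ka i <= rowlen la i & rowlen la i.+1 <= rowlen ka i]%N.
  by rewrite mem_s => /andP [/stripP h1 /stripP h2] i; case: (h1 i); case: (h2 i).
have lt_m : (i0 < m)%N.
  by rewrite ltnW // ltnS -rowlen_gt0 (leq_ltn_trans _ lt_i0).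
have fl_bounds ka : ka \in s -> forall i,
    [/\ rowlen nu i <= fl ka i, fl ka i <= (rowlen nu i).+1,
        fl ka i <= rowlen la i & rowlen la i.+1 <= fl ka i]%N.
  move=> kas i; have := stripsP ka kas i; rewrite /fl; case: eqP => // ->.
  have := eq_i i0.+1 (leqnn _); have := rowlen_anti nu (leqnSn i0).
  by move: lt_i0 => + + + [? ? ? ?]; split; lia.
have tg_row ka : ka \in s -> forall i, rowlen (tg ka) i = fl ka i.
  move=> kas i; apply: rowlen_mkpart => [j|].
    by have [? ? ? ?] := fl_bounds ka kas j; have [] := fl_bounds ka kas j.+1; lia.
  have [_ _ + _] := fl_bounds ka kas m.
  by rewrite (@rowlen_eq0 la m) ?leqn0 => [/eqP|].
have tg_s ka : ka \in s -> tg ka \in s.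
  move=> kas; rewrite mem_s; apply/andP; split; apply/stripP => i;
    by rewrite tg_row //; have [] := fl_bounds ka kas i.
have tgK ka : ka \in s -> tg (tg ka) = ka.
  move=> kas; apply: intpart_eqP => i; rewrite tg_row ?tg_s // /fl tg_row // /fl.
  by have [] := stripsP ka kas i; case: eqP => // ->; lia.
have tg_sign ka : ka \in s ->
    (-1) ^+ weight (tg ka) = - (-1) ^+ weight ka :> int.
  move=> kas; have size_m xi : xi \in s -> (size xi <= m)%N.
    move=> xis; rewrite leqNgt -rowlen_gt0 -leqNgt.
    have [_ _ + _] := stripsP xi xis m.
    by rewrite (@rowlen_eq0 la m) // leqn0 => /eqP ->.
  rewrite (weightE (size_m _ kas)) (weightE (size_m _ (tg_s _ kas))).
  rewrite (bigD1 (Ordinal lt_m)) //= [in RHS](bigD1 (Ordinal lt_m)) //=.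
  rewrite [in LHS](eq_bigr (fun i : 'I_m => rowlen ka i)); last first.
    move=> i ne; rewrite tg_row // /fl -[i0]/(val (Ordinal lt_m)).
    by rewrite (inj_eq val_inj) (negPf ne).
  rewrite tg_row // /fl eqxx !exprD -mulNr; congr (_ * _).
  have [h1 h2 _ _] := stripsP ka kas i0.
  rewrite -signr_odd -[in RHS]signr_odd oddB ?doubleS //=; last by lia.
  by rewrite odd_double; case: (odd _).
have : \sum_(ka <- s) (-1) ^+ weight ka = - \sum_(ka <- s) (-1) ^+ weight ka :> int.
  have tg_perm : perm_eq s [seq tg ka | ka <- s].
    have us : uniq s by rewrite filter_uniq ?uniq_ptsle.
    apply: uniq_perm => // [|ka].
      rewrite map_inj_in_uniq // => x y xs ys eq_tg.
      by rewrite -(tgK x xs) eq_tg tgK.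
    apply/idP/mapP => [kas|[x xs ->]]; last exact: tg_s.
    by exists (tg ka); rewrite ?tgK ?tg_s.
  rewrite [LHS](perm_big _ tg_perm) big_map /= -sumrN !big_seq.
  exact: eq_bigr.
by move: (\sum_(ka <- s) _) => z; lia.
Qed.

(** Pieri's rule for the h_i turns the left-hand side into a combination of the [seq_schur v la],
    with coefficients the signed sums of [sum_sign_strips] up to sign. They vanish since [0 < k]
    forces [la] to differ from [mu]. The inner sum stands for the product of e_(k-i) with
    [seq_schur v mu], an identity still to be proved. *)
Lemma complete_strips (k : nat) mu v : (0 < k)%N ->
  \sum_(i < k.+1) (-1) ^+ i * complete v i *
    (\sum_(la <- pts (weight mu + (k - i)) | strip true mu la) seq_schur v la)
  = 0.
Proof.
move=> k_gt0; set D := (weight mu + k)%N.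
transitivity (\sum_(la <- pts D) \sum_(ka <- ptsle D |
    strip true mu ka && strip false ka la)
    (-1) ^+ (weight la - weight ka) * seq_schur v la); last first.
  rewrite big_seq big1 // => la; rewrite mem_pts => /eqP wla.
  have neq : mu != la by apply/eqP => eq_la; move: wla; rewrite -eq_la /D; lia.
  have := congr1 (fun z : int => z%:~R : R) (sum_sign_strips neq).
  rewrite /= rmorph_sum /= wla => eq0; rewrite -mulr_suml.
  rewrite (eq_bigr (fun ka => (-1) ^+ D * ((-1) ^+ weight ka)%:~R)) => [|ka].
    by rewrite -mulr_sumr eq0 mulr0 mul0r.
  case/andP => _ /strip_weight; rewrite wla => le_D.
  rewrite rmorphXn /= -exprD -[LHS]signr_odd -[RHS]signr_odd.
  by rewrite oddB // oddD.
rewrite [RHS](exchange_big_dep (strip true mu)) => [|la ka _ /andP [] //].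
under [LHS]eq_bigr => i _ do rewrite -mulrA mulr_sumr.
transitivity (\sum_(i < k.+1) \sum_(ka <- ptsle D | strip true mu ka &&
  (weight ka == weight mu + (k - i))%N) (-1) ^+ i *
   \sum_(la <- pts D | strip false ka la) seq_schur v la).
  apply: eq_bigr => i _; rewrite mulr_sumr.
  rewrite (eq_big_uniq (ptsle D) (fun ka => strip true mu ka &&
    (weight ka == weight mu + (k - i))%N)) ?uniq_pts ?uniq_ptsle // => [|ka].
    apply: eq_bigr => ka /andP [_ /eqP wka].
    rewrite pieri_complete wka; congr (_ * \sum_(_ <- pts _ | _) _).
    by have := ltn_ord i; rewrite /D; lia.
  rewrite mem_pts mem_ptsle; case: (strip true mu ka); rewrite ?andbF //=.
  by rewrite andbT; apply/idP/andP => [|[]]; rewrite /D; lia.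
rewrite [LHS](exchange_big_dep (strip true mu)) /= => [|i ka _ /andP [] //].
rewrite [LHS]big_seq_cond [RHS]big_seq_cond.
apply: eq_bigr => ka; rewrite mem_ptsle => /andP [le_D st].
have wmu := strip_weight st.
have lt_i : (D - weight ka < k.+1)%N by rewrite /D; lia.
rewrite (big_pred1 (Ordinal lt_i)) => [|i] /=; last first.
  rewrite st /=; apply/eqP/eqP => [h|-> /=]; last by rewrite /D in le_D *; lia.
  by apply: val_inj; rewrite /= h /D; have := ltn_ord i; lia.
rewrite mulr_sumr [LHS]big_seq_cond [RHS]big_seq_cond.
apply: eq_big => [la|la]; first by rewrite st.
by rewrite mem_pts => /andP [/eqP -> _].
Qed.

(** By [complete_strips], the right-hand side satisfies a recursion in [k] whose coefficients do not
    depend on [mu]. The case [mu = part0] is the recursion of e_k itself, so both sides agree by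
    induction. *)
Lemma pieri_elementary v k mu :
  elementary v k * seq_schur v mu =
  \sum_(la <- pts (weight mu + k) | strip true mu la) seq_schur v la.
Proof.
have complete0 : complete v 0 = 1.
  by elim: v => //= x v' IH; rewrite big_ord1 mul1r.
elim/ltn_ind: k => -[_|k IH].
  rewrite addn0 (eq_big_uniq [:: mu] xpredT) ?uniq_pts // => [|la].
    rewrite big_seq1 /elementary (eq_big_uniq [:: part0] xpredT) ?uniq_pts //.
      by rewrite big_seq1 /seq_schur super_schur_part0 mul1r.
    move=> la; rewrite mem_pts inE andbT.
    by apply/andP/eqP => [[/eqP/weight0]|->] //; rewrite strip_refl.
  rewrite mem_pts inE andbT; apply/andP/eqP => [[/eqP wla st]|->].
    by apply/esym/weight_lt_eq => //; apply: strip_rowlen st.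
  by rewrite eqxx strip_refl.
have rec nu : \sum_(la <- pts (weight nu + k.+1) | strip true nu la)
    seq_schur v la = - \sum_(i < k.+1) (-1) ^+ i.+1 * complete v i.+1 *
    \sum_(la <- pts (weight nu + (k - i)) | strip true nu la) seq_schur v la.
  have := complete_strips nu v (ltn0Sn k).
  rewrite big_ord_recl /= subn0 expr0 complete0 !mul1r => /eqP.
  by rewrite addr_eq0 => /eqP ->.
rewrite rec {1}/elementary (rec part0) mulNr mulr_suml; congr (- _).
apply: eq_bigr => i _; rewrite -[LHS]mulrA; congr (_ * _).
by rewrite -IH // ltnS leq_subr.
Qed.

Definition piece v (p : bool * nat) : R :=
  if p.1 then elementary v p.2 else complete v p.2.

Lemma pieri v p mu : piece v p * seq_schur v mu =
  \sum_(la <- pts (weight mu + p.2) | strip p.1 mu la) seq_schur v la.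
Proof.
by case: p => -[] k; rewrite /piece (pieri_elementary, pieri_complete).
Qed.

End Branching.

(* [chains w la] counts the chains of strips of the given kinds and sizes
   from the empty partition to [la]; as in [super_schur], the head of the
   list is the outermost strip. *)
Fixpoint chains (w : seq (bool * nat)) (la : intpart) : nat :=
  if w is (b, k) :: w' then
    \sum_(mu <- ptsle (weight la) |
        strip b mu la && (weight la == weight mu + k)) chains w' mu
  else la == part0.

Definition wsize (w : seq (bool * nat)) : nat := sumn [seq p.2 | p <- w].

Lemma chains_weight w la : weight la != wsize w -> chains w la = 0%N.
Proof.
elim: w la => [|[b k] w IH] la /= ne.
  by case: (la =P part0) ne => // ->.
apply: big1 => mu /andP [_ /eqP wla]; apply: IH.
by apply: contraNneq ne => wmu; rewrite wla wmu /wsize /= addnC.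
Qed.

(** Pieri's rules applied letter by letter, starting from the Schur function 1 of the empty
    partition. *)
Lemma prod_pieces (R : comNzRingType) (v : seq R) w :
  \prod_(p <- w) piece v p =
  \sum_(la <- pts (wsize w)) (chains w la)%:R * seq_schur v la.
Proof.
elim: w => [|[b k] w IH].
  rewrite big_nil (eq_big_uniq [:: part0] xpredT) ?uniq_pts //.
    by rewrite big_seq1 /seq_schur super_schur_part0 mulr1.
  by move=> la; rewrite mem_pts inE andbT andbT; apply/eqP/eqP => [/weight0|->].
rewrite big_cons IH mulr_sumr.
transitivity (\sum_(mu <- pts (wsize w)) \sum_(la <- pts (wsize ((b, k) :: w)) |
    strip b mu la) (chains w mu)%:R * seq_schur v la).
  rewrite !big_seq; apply: eq_bigr => mu; rewrite mem_pts => /eqP wmu.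
  by rewrite mulrCA pieri -mulr_sumr wmu /= addnC.
rewrite (exchange_big_dep xpredT) //= !big_seq; apply: eq_bigr => la.
rewrite mem_pts => /eqP wla; rewrite -mulr_suml; congr (_ * _).
rewrite natr_sum; apply: eq_big_uniq; rewrite ?uniq_pts ?uniq_ptsle // => mu.
rewrite mem_pts mem_ptsle wla /wsize /= addnC eqn_add2r eq_sym.
by case: eqP => [->|]; rewrite ?andbF ?leq_addr ?andbT.
Qed.

Implicit Types la mu nu : intpart.

(** * Symmetry, triangularity and conjugation *)

Lemma super_schur_morph (R S : comNzRingType) (f : {rmorphism R -> S}) w la :
  f (super_schur w la) = super_schur [seq (p.1, f p.2) | p <- w] la.
Proof.
elim: w la => [|[b x] w IH] la /=; first by rewrite rmorph_nat.
rewrite rmorph_sum /=; apply: eq_bigr => mu _.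
by rewrite rmorphM rmorphXn /= IH.
Qed.

Lemma seq_schur_morph (R S : comNzRingType) (f : {rmorphism R -> S}) v la :
  f (seq_schur v la) = seq_schur [seq f x | x <- v] la.
Proof. by rewrite /seq_schur super_schur_morph -!map_comp. Qed.

Lemma seq_schur0 (R : comNzRingType) (v : seq R) la :
  seq_schur (0 :: v) la = seq_schur v la.
Proof.
rewrite seq_schur_cons (bigID (pred1 la)) /= [X in _ + X]big1_seq ?addr0.
  rewrite (eq_big_uniq [:: la] xpredT) ?uniq_ptsle // => [|mu].
    by rewrite big_seq1 subnn mul1r.
  rewrite mem_ptsle inE andbT; case: (mu =P la) => [->|]; rewrite ?andbF //.
  by rewrite strip_refl leqnn.
move=> mu /andP [/andP [st ne] _].
case: (leqP (weight la) (weight mu)) => h; last first.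
  by rewrite expr0n subn_eq0 leqNgt h mul0r.
case/eqP: ne; apply: weight_lt_eq; first exact: strip_rowlen st.
by apply/eqP; rewrite eqn_leq h (strip_weight st).
Qed.

(** It suffices to exchange two neighbours [x] and [y]. Clearing the factors 1 - xt and 1 - yt of
    the generating function gives the recursion [rec2], which is visibly symmetric in them. *)
Lemma complete_perm (R : comNzRingType) (v v' : seq R) k :
  perm_eq v v' -> complete v k = complete v' k.
Proof.
have rec x (u : seq R) n : complete (x :: u) n.+1 =
    complete u n.+1 + x * complete (x :: u) n.
  rewrite /= big_ord_recl mul1r subn0 mulr_sumr; congr (_ + _).
  by apply: eq_bigr => j _; rewrite exprS mulrA.
have rec0 x (u : seq R) : complete (x :: u) 0 = complete u 0.
  by rewrite /= big_ord1 mul1r.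
have rec2 x y (u : seq R) n : complete (x :: y :: u) n.+2 = complete u n.+2 +
    (x + y) * complete (x :: y :: u) n.+1 - x * y * complete (x :: y :: u) n.
  by rewrite (rec x _ n.+1) (rec y u n.+1) (rec x (y :: u) n); ring.
have swap x y (u : seq R) n :
    complete (x :: y :: u) n = complete (y :: x :: u) n.
  elim/ltn_ind: n => -[_|[_|n IH]]; first by rewrite !rec0.
    by rewrite !rec !rec0; ring.
  by rewrite (rec2 x) (rec2 y) !IH // [y + x]addrC [y * x]mulrC.
have swap_cons x (u u' : seq R) :
    (forall n, complete u n = complete u' n) ->
    forall n, complete (x :: u) n = complete (x :: u') n.
  by move=> h n /=; apply: eq_bigr => j _; rewrite h.
have front x (s t : seq R) n : complete (s ++ x :: t) n = complete (x :: s ++ t) n.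
  elim: s n => // y s IH n; rewrite /= -/(complete (y :: s ++ x :: t) n).
  by rewrite -[RHS]swap; apply: swap_cons.
elim: v v' k => [|x v IH] v' k; first by rewrite perm_sym => /perm_nilP ->.
move=> h; have x_v' : x \in v' by rewrite -(perm_mem h) mem_head.
case/splitPr: x_v' h => s t h; rewrite front; apply: swap_cons => n; apply: IH.
by move: h; rewrite perm_sym -(cat1s x t) perm_catCA perm_cons perm_sym.
Qed.

(** The list is reversed because the head of a word is the outermost strip: the first entry of [s]
    is the first strip to be added. *)
Definition hword (s : seq nat) : seq (bool * nat) := [seq (false, k) | k <- rev s].

(* The statistic [sum_i i la_i] decreases in the dominance order. *)
Definition rowstat (la : intpart) : nat := (\sum_(i < size la) i * rowlen la i)%N.

Lemma rowstatE la m : (size la <= m)%N ->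
  rowstat la = (\sum_(i < m) i * rowlen la i)%N.
Proof.
move=> le_m; rewrite /rowstat -(big_mkord xpredT (fun i => i * rowlen la i)%N).
rewrite -[RHS](big_mkord xpredT (fun i => i * rowlen la i)%N).
rewrite [in RHS](big_cat_nat _ (n := size la)) //=.
rewrite [X in (_ = _ + X)%N]big_nat_cond [X in (_ + X)%N]big1 ?addn0 // => i.
by case/andP => /andP [h _] _; rewrite rowlen_eq0 ?muln0.
Qed.

(** The new cells lie in rows 0 to [l], and a cell in row [i] adds [i <= l] to the statistic.
    Equality therefore puts all of them in row [l], leaving the earlier rows untouched. *)
Lemma strip_rowstat (mu la : intpart) l : strip false mu la ->
  (size mu <= l)%N ->
  [/\ (size la <= l.+1)%N,
      (rowstat la <= rowstat mu + l * (weight la - weight mu))%N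
    & rowstat la = (rowstat mu + l * (weight la - weight mu))%N ->
      forall i, (i < l)%N -> rowlen la i = rowlen mu i].
Proof.
move=> st le_l; have sub := strip_rowlen st.
have la_l : (size la <= l.+1)%N.
  rewrite leqNgt -rowlen_gt0 -leqNgt; move/stripP: st => /(_ l) [_].
  by rewrite (rowlen_eq0 le_l).
(* The deficit, computed exactly: a new cell in row [i] falls short of the bound by [l - i]. *)
have gap : (rowstat la + \sum_(i < l.+1) (l - i) * (rowlen la i - rowlen mu i) =
    rowstat mu + l * (weight la - weight mu))%N.
  have -> : (weight la - weight mu = \sum_(i < l.+1) (rowlen la i - rowlen mu i))%N.
    rewrite (weightE la_l) (weightE (leqW le_l)).
    by rewrite -sumnB // => i _; apply: sub.
  rewrite (rowstatE la_l) (rowstatE (leqW le_l)) big_distrr -!big_split /=.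
  by apply: eq_bigr => i _; have := sub i; have := ltn_ord i; nia.
split=> // [|eq_st i lt_i]; first by lia.
have : (\sum_(i < l.+1) (l - i) * (rowlen la i - rowlen mu i))%N == 0%N by lia.
rewrite sum_nat_eq0 => /forallP /(_ (Ordinal (leqW lt_i))) /=.
rewrite muln_eq0 subn_eq0 leqNgt lt_i /= subn_eq0 => h.
by apply/eqP; rewrite eqn_leq h sub.
Qed.

Lemma hword_rcons s k : hword (rcons s k) = (false, k) :: hword s.
Proof. by rewrite /hword rev_rcons. Qed.

Lemma wsize_hword s : wsize (hword s) = sumn s.
Proof. by rewrite /wsize -map_comp map_id_in // sumn_rev. Qed.

Definition seqstat (s : seq nat) : nat := (\sum_(i < size s) i * nth 0%N s i)%N.

Lemma seqstat_rcons s k : seqstat (rcons s k) = (seqstat s + size s * k)%N.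
Proof.
rewrite /seqstat size_rcons big_ord_recr /= nth_rcons ltnn eqxx; congr (_ + _)%N.
by apply: eq_bigr => i _; rewrite nth_rcons ltn_ord.
Qed.

(** A weak form of the fact that a Kostka number is nonzero only for shapes dominating the content:
    dominance is recorded through the statistic alone, which [strip_rowstat] controls one strip at a
    time. The equality case is what separates the diagonal. *)
Lemma chains_hword_tri (s : seq nat) (la : intpart) : chains (hword s) la != 0%N ->
  [/\ (size la <= size s)%N, (rowstat la <= seqstat s)%N
    & rowstat la = seqstat s -> forall i, rowlen la i = nth 0%N s i].
Proof.
elim/last_ind: s la => [|s k IH] la.
  rewrite /= eqb0 negbK => /eqP ->; rewrite /rowstat /seqstat !big_ord0.
  by split=> // _ i; rewrite !nth_nil.
rewrite hword_rcons /= => h.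
have [mu /andP [st /eqP wla] ch] : exists2 mu,
    strip false mu la && (weight la == weight mu + k)%N & chains (hword s) mu != 0%N.
  have : has (fun mu => (strip false mu la && (weight la == weight mu + k)%N) &&
    (chains (hword s) mu != 0%N)) (ptsle (weight la)).
    apply: contraNT h => /hasPn h; apply/eqP; rewrite big_seq_cond big1 // => mu.
    by case/andP => /h; rewrite negb_and => + hmu; rewrite hmu negbK => /eqP.
  by case/hasP => mu _ /andP [h1 h2]; exists mu.
have [sz rs eqs] := IH mu ch; have [szl rsl eql] := strip_rowstat st sz.
rewrite size_rcons seqstat_rcons; move: rsl eql; rewrite wla addKn => rsl eql.
split=> // [|eq_st]; first by lia.
have rmu := eqs ltac:(lia); have rla := eql ltac:(lia).
move=> i; rewrite nth_rcons; case: ltngtP => h1.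
- by rewrite rla.
- by rewrite rowlen_eq0 // (leq_trans szl).
have := wla; rewrite (weightE szl) (weightE (leqW sz)) !big_ord_recr /= h1.
rewrite (rowlen_eq0 sz) addn0 (eq_bigr (fun i : 'I_(size s) => rowlen mu i)).
  by move/addnI.
by move=> j _; apply: rla.
Qed.

(** The last strip of such a chain must fill the last row of [la]: otherwise the statistic would
    stay below that of [la]. Hence the previous partition is [la] without its last row, and
    induction applies. *)
Lemma chains_hword_diag (la : intpart) : chains (hword la) la = 1%N.
Proof.
case: la => s; elim/last_ind: s => [|s k IH] pf; first by [].
have pf' : is_part s.
  move: pf; rewrite /is_part mem_rcons inE negb_or => /and3P [+ _ ->].
  rewrite andbT -cats1; case: (s) => //= x t; rewrite cat_path; by case/andP.
set la := IntPart pf; pose mu := IntPart pf'.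
have row_la i : rowlen la i = if i == size s then k else rowlen mu i.
  rewrite /= nth_rcons; case: ltngtP => // h; by rewrite nth_default // ltnW.
have wla : weight la = (weight mu + k)%N by rewrite /= sumn_rcons.
have st : strip false mu la.
  apply/stripP => i; split.
    rewrite row_la; case: eqP => // ->; by rewrite rowlen_eq0.
  rewrite row_la; case: eqP => [h|_]; last by apply: rowlen_anti.
  have := rowlen_anti la (leqnSn i); rewrite !row_la h eqxx.
  by case: eqP => // h'; lia.
have stat_la : rowstat la = (rowstat mu + size s * k)%N by exact: seqstat_rcons.
rewrite /= hword_rcons /= -/la (bigID (pred1 mu)) /=.
rewrite [X in (_ + X)%N]big1_seq ?addn0 => [|nu].
  rewrite (eq_big_uniq [:: mu] xpredT) ?uniq_ptsle // => [|nu].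
    by rewrite big_seq1; apply: IH.
  rewrite mem_ptsle inE andbT; case: (nu =P mu) => [->|]; rewrite ?andbF //.
  by rewrite st wla eqxx leq_addr.
case/andP => /andP [/andP [st_nu /eqP w_nu] ne] _; apply: contraNeq ne => ch.
have [sz rs eqs] := chains_hword_tri ch; have [_ rsl _] := strip_rowstat st_nu sz.
have wk : (weight la - weight nu = k)%N by rewrite w_nu addKn.
apply/eqP/intpart_eqP/eqs; apply/eqP; rewrite eqn_leq rs /=.
by move: rsl; rewrite stat_la wk leq_add2r.
Qed.

Lemma chains_hword_triangular la nu : chains (hword la) nu != 0%N -> nu != la ->
  (rowstat nu < rowstat la)%N.
Proof.
move=> ch ne; have [_ rs eqs] := chains_hword_tri ch.
rewrite ltn_neqAle rs andbT; apply: contraNneq ne => /eqs eq_row.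
by apply/eqP/intpart_eqP.
Qed.

Lemma chains_wsize w la : chains w la != 0%N -> weight la = wsize w.
Proof. by move=> ch; apply/eqP; apply: contraNT ch => /chains_weight ->. Qed.

(** Triangularity writes a Schur polynomial as a product of the h_k, symmetric by [complete_perm],
    minus Schur polynomials with a smaller statistic. *)
Lemma seq_schur_perm (R : comNzRingType) (v v' : seq R) la :
  perm_eq v v' -> seq_schur v la = seq_schur v' la.
Proof.
move=> vv'; have [n] := ubnP (rowstat la); elim: n la => // n IH la lt_n.
have E (u : seq R) : seq_schur u la = \prod_(p <- hword la) piece u p -
    \sum_(nu <- pts (weight la) | nu != la) (chains (hword la) nu)%:R * seq_schur u nu.
  rewrite prod_pieces wsize_hword [\sum_(_ <- _) _](bigD1_seq la) ?uniq_pts ?mem_pts //=.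
  by rewrite chains_hword_diag mul1r addrK.
rewrite !E; congr (_ - _).
  by rewrite !big_map; apply: eq_bigr => k _; rewrite /piece /= (complete_perm _ vv').
apply: eq_bigr => nu ne; have [->|ch] := eqVneq (chains (hword la) nu) 0%N.
  by rewrite !mul0r.
by rewrite IH // (leq_trans (chains_hword_triangular ch ne)).
Qed.

(** The Kostka matrix in degree [d]. *)
Definition chain_mx (d : nat) : 'M[rat]_(size (pts d)) :=
  \matrix_(i, j) (chains (hword (nth part0 (pts d) i)) (nth part0 (pts d) j))%:R.

(** Unitriangularity without sorting [pts d]: by induction on the statistic, each unit vector is a
    row of the matrix minus a combination of unit vectors already in its row space. *)
Lemma chain_mx_unit (d : nat) : chain_mx d \in unitmx.
Proof.
set K := chain_mx d; set s := pts d; rewrite -row_full_unit -sub1mx.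
apply/row_subP => i; rewrite rowE mulmx1.
have [n] := ubnP (rowstat (nth part0 s i)); elim: n i => // n IH i lt_n.
have us : uniq s := uniq_pts d.
have -> : delta_mx 0 i = matrix.row i K - \sum_(j | j != i)
    K i j *: delta_mx 0 j.
  rewrite [X in X - _]row_sum_delta (bigD1 i) //= !mxE chains_hword_diag scale1r.
  rewrite -addrA -sumrB big1 ?addr0 // => j _; rewrite !mxE.
  by rewrite subrr.
rewrite addmx_sub ?row_sub // eqmx_opp summx_sub // => j ne; rewrite mxE.
have [->|ch] := eqVneq (chains (hword (nth part0 s i)) (nth part0 s j)) 0%N.
  by rewrite scale0r sub0mx.
rewrite scalemx_sub // IH // (leq_trans (chains_hword_triangular ch _)) //.
by rewrite nth_uniq.
Qed.

(** * Conjugate partitions *)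

Lemma count_gt_nth (s : seq nat) i j : sorted geq s ->
  (i < count (fun r => j < r)%N s)%N = (j < nth 0%N s i)%N.
Proof.
elim: s i => [|a s IH] i; first by rewrite nth_nil.
move=> srt; have srt' := path_sorted srt; rewrite /=.
have [lt_a|ge_a] := ltnP j a; first by case: i => [|i] //=; rewrite ltnS IH.
have -> : count (fun r => j < r)%N s = 0%N.
  apply/eqP; rewrite -leqn0 leqNgt -has_count; apply/hasPn => r rs.
  have /allP /(_ r rs) /= := order_path_min (rev_trans leq_trans) srt.
  by rewrite -leqNgt => /leq_trans; apply.
case: i => [|i] /=; first by rewrite [RHS]ltnNge ge_a.
have [lt_i|/(nth_default 0%N) -> //] := ltnP i (size s).
have /allP /(_ _ (mem_nth 0%N lt_i)) /= := order_path_min (rev_trans leq_trans) srt.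
by move=> h; rewrite addn0 !ltnNge /= (leq_trans h ge_a).
Qed.

(** Both sides say that the cell in row [i] and column [j] belongs to the diagram of [la]. This
    symmetric form is the source of all later facts about conjugation. *)
Lemma rowlen_conj la i j : (i < rowlen (conj_part la) j)%N = (j < rowlen la i)%N.
Proof.
have srt : sorted geq la by case: la => s /= /andP [].
have [lt_j|ge_j] := ltnP j (head 0%N la).
  by rewrite (nth_map 0%N) ?size_iota // nth_iota // count_gt_nth.
rewrite nth_default ?size_map ?size_iota // ltn0; apply/esym/negbTE.
by rewrite -leqNgt; apply: leq_trans ge_j; rewrite -nth0 rowlen_anti.
Qed.

Lemma eq_ltn a b : (forall i, (i < a)%N = (i < b)%N) -> a = b.
Proof. by move=> h; have := h a; have := h b; lia. Qed.

Lemma conj_partK : involutive conj_part.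
Proof.
move=> la; apply: intpart_eqP => i; apply: eq_ltn => j.
by rewrite !rowlen_conj.
Qed.

Lemma strip_conj b mu la :
  strip b mu la -> strip (~~ b) (conj_part mu) (conj_part la).
Proof.
move=> /stripP st; apply/stripP => i; split.
  rewrite leqNgt; apply/negP; rewrite rowlen_conj => h.
  have := rowlen_conj la (rowlen (conj_part la) i) i; rewrite ltnn => /esym/negbT.
  by rewrite -leqNgt; have [] := st (rowlen (conj_part la) i); lia.
set a := rowlen (conj_part mu) i.
have := rowlen_conj mu a i; rewrite ltnn => /esym/negbT; rewrite -leqNgt.
have [_] := st a; case: (b) => /=; rewrite leqNgt => h1 h2;
  rewrite leqNgt; apply/negP; rewrite rowlen_conj; lia.
Qed.

Lemma weight_conj la : weight (conj_part la) = weight la.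
Proof.
pose m := (weight la + weight (conj_part la))%N.
have bd mu : (weight mu <= m)%N ->
    (weight mu = \sum_(i < m) \sum_(j < m) (j < rowlen mu i))%N.
  move=> le_m; rewrite (@weightE mu m) ?(leq_trans (weight_size _)) //.
  apply: eq_bigr => i _; rewrite -(big_mkord xpredT (fun j => (j < rowlen mu i : nat)))%N.
  rewrite -big_mkcond /= -(big_nat_widen _ _ _ xpredT) ?sum_nat_const_nat ?subn0 ?muln1 //.
  exact: leq_trans (rowlen_le_weight _ _) _.
rewrite (bd _ (leq_addl _ _)) [RHS](bd _ (leq_addr _ _)) exchange_big /=.
by apply: eq_bigr => i _; apply: eq_bigr => j _; rewrite rowlen_conj.
Qed.

(** The involution that exchanges h_k and e_k, on the level of chains: conjugating every partition
    of a chain turns horizontal strips into vertical ones of the same size. *)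
Lemma chains_conj w la :
  chains [seq (~~ p.1, p.2) | p <- w] la = chains w (conj_part la).
Proof.
elim: w la => [|[b k] w IH] la /=.
  congr nat_of_bool; apply/eqP/eqP => [->|h]; last first.
    by apply: weight0; rewrite -weight_conj h.
  by apply: weight0; rewrite weight_conj.
rewrite weight_conj.
have mem_map_ptsle D : perm_eq (ptsle D) [seq conj_part mu | mu <- ptsle D].
  apply: uniq_perm; rewrite ?uniq_ptsle ?map_inj_uniq ?uniq_ptsle //.
    exact: inv_inj conj_partK.
  move=> mu; rewrite mem_ptsle; apply/idP/mapP => [h|[nu + ->]].
    by exists (conj_part mu); rewrite ?conj_partK // mem_ptsle weight_conj.
  by rewrite mem_ptsle weight_conj.
rewrite [LHS](perm_big _ (mem_map_ptsle _)) big_map /=.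
apply: eq_big => mu; last by rewrite IH conj_partK.
rewrite weight_conj; congr (_ && _); apply/idP/idP => /strip_conj.
  by rewrite conj_partK negbK.
by rewrite conj_partK.
Qed.

(** * Tableaux *)

Section Cells.
Variable la : intpart.

Lemma cell_col_lt (c : cell la) : (cell_col c < rowlen la (cell_row c))%N.
Proof. by case: c => i j; apply: ltn_ord. Qed.

Lemma cell_row_lt i j : (j < rowlen la i)%N -> (i < size la)%N.
Proof. by rewrite -rowlen_gt0; apply: leq_ltn_trans. Qed.

Definition cell_at i j (lt_j : (j < rowlen la i)%N) : cell la :=
  @Tagged _ (Ordinal (cell_row_lt lt_j)) (fun i : 'I_(size la) => 'I_(nth 0%N la i))
    (Ordinal lt_j).

Lemma cell_row_at i j (lt_j : (j < rowlen la i)%N) : cell_row (cell_at lt_j) = i.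
Proof. by []. Qed.

Lemma cell_col_at i j (lt_j : (j < rowlen la i)%N) : cell_col (cell_at lt_j) = j.
Proof. by []. Qed.

Lemma cell_inj (c d : cell la) :
  cell_row c = cell_row d -> cell_col c = cell_col d -> c = d.
Proof.
case: c d => [i j] [i' j']; rewrite /cell_row /cell_col /= => /val_inj eq_i.
by case: i' / eq_i j' => j' /val_inj ->.
Qed.

Lemma card_cell : #|{: cell la}| = weight la.
Proof.
rewrite card_tagged sumnE big_map big_enum /= (weightE (leqnn _)).
by apply: eq_bigr => i _; rewrite card_ord.
Qed.

Lemma hook_ssP k N (T : filling la N) :
  reflect (forall c d : cell la,
    (left_of c d -> (T c <= T d)%N /\ (T c = T d -> (T c < k)%N)) /\
    (above c d -> (T c <= T d)%N /\ (T c = T d -> (k <= T c)%N)))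
  [forall c, forall d,
    (left_of c d ==> (T c <= T d)%N && ((T c == T d) ==> (T c < k)%N)) &&
    (above c d ==> (T c <= T d)%N && ((T c == T d) ==> (k <= T c)%N))].
Proof.
apply: (iffP forallP) => [h c d|h c].
  have /forallP/(_ d)/andP [/implyP h1 /implyP h2] := h c.
  by split=> [/h1|/h2] /andP [-> /implyP h3]; split=> // /eqP /h3.
apply/forallP => d; have [h1 h2] := h c d.
by apply/andP; split; apply/implyP; [move/h1 | move/h2] => -[-> h3] /=;
  apply/implyP => /eqP/h3.
Qed.

End Cells.

Section Embedding.
Variables (mu la : intpart) (sub : forall i, (rowlen mu i <= rowlen la i)%N).

Definition emb (d : cell mu) : cell la :=
  cell_at (leq_trans (cell_col_lt d) (sub _)).

Definition inner (c : cell la) : bool := (cell_col c < rowlen mu (cell_row c))%N.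

Definition retr (c : cell la) : option (cell mu) :=
  [pick d | (cell_row d == cell_row c) && (cell_col d == cell_col c)].

Lemma emb_inj : injective emb.
Proof.
move=> c d eq_cd; apply: cell_inj.
  exact: (congr1 (@cell_row la) eq_cd).
exact: (congr1 (@cell_col la) eq_cd).
Qed.

Lemma inner_emb d : inner (emb d). Proof. exact: cell_col_lt. Qed.

Lemma innerP c : inner c -> exists d, c = emb d.
Proof. by move=> lt_c; exists (cell_at lt_c); apply: cell_inj. Qed.

Lemma retr_emb d : retr (emb d) = Some d.
Proof.
rewrite /retr; case: pickP => [e /andP [/eqP h1 /eqP h2]|/(_ d)].
  by congr Some; apply: cell_inj.
by rewrite !eqxx.
Qed.

Lemma retr_outer c : ~~ inner c -> retr c = None.
Proof.
rewrite /retr; case: pickP => // e /andP [/eqP h1 /eqP h2].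
by rewrite /inner -h1 -h2 cell_col_lt.
Qed.

Lemma card_outer : #|[pred c | ~~ inner c]| = (weight la - weight mu)%N.
Proof.
rewrite -!card_cell -(cardC (fun c => inner c)).
have -> : #|(fun c => inner c)| = #|{: cell mu}|.
  rewrite -(card_image emb_inj); apply: eq_card => c.
  apply/idP/imageP => [/innerP [d ->]|[d _ ->]]; first by exists d.
  exact: inner_emb.
by rewrite addKn; apply: eq_card.
Qed.

Lemma prod_inner (R : comNzRingType) (F : cell la -> R) :
  \prod_(c | inner c) F c = \prod_(d : cell mu) F (emb d).
Proof.
transitivity (\prod_(c in emb @: [set: cell mu]) F c).
  apply: eq_bigl => c; apply/idP/imsetP => [/innerP [d ->]|[d _ ->]].
    by exists d; rewrite ?inE.
  exact: inner_emb.
rewrite big_imset /= => [|? ? _ _]; last exact: emb_inj.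
by apply: eq_bigl => d; rewrite inE.
Qed.

End Embedding.

(** * Removing the largest letter of a tableau *)

Section TableauBranching.
Variables (R : comNzRingType) (k N : nat) (x : nat -> R).

(** The condition [hook_semistandard] with an alphabet size [N] freed from the form [k + l]; the
    case [k = N] then covers ordinary tableaux. *)
Definition hook_ss la (T : filling la N) : bool :=
  [forall c, forall d,
    (left_of c d ==> (T c <= T d)%N && ((T c == T d) ==> (T c < k)%N)) &&
    (above c d ==> (T c <= T d)%N && ((T c == T d) ==> (k <= T c)%N))].

Definition letters_below la (p : nat) (T : filling la N) : bool :=
  [forall c, T c < p]%N.

Definition tableau_sum la p : R :=
  \sum_(T : filling la N | hook_ss T && letters_below p T) \prod_c x (T c).

Definition fits la p mu (T : filling la N) : bool :=
  [forall c, (T c < p)%N == inner mu c].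

(** Cut row [i] at the first column from which on all letters are at least [p]. Rows being
    non-decreasing, exactly the letters below [p] remain; columns being non-decreasing, the cuts
    form a partition. *)
Lemma fits_exists la p (T : filling la N) : hook_ss T ->
  exists2 mu, fits p mu T & forall i, (rowlen mu i <= rowlen la i)%N.
Proof.
move/hook_ssP => ss.
pose P i j := [forall c : cell la,
  (cell_row c == i) && (j <= cell_col c)%N ==> (p <= T c)%N].
have P_la i : P i (rowlen la i).
  apply/forallP => c; apply/implyP => /andP [/eqP <-].
  by rewrite leqNgt cell_col_lt.
have exP i : exists j, P i j by exists (rowlen la i).
pose f i := ex_minn (exP i).
have f_P i : P i (f i) by rewrite /f; case: ex_minnP.
have f_min i j : P i j -> (f i <= j)%N.
  by rewrite /f; case: ex_minnP => m _; apply.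
have f_la i : (f i <= rowlen la i)%N by apply: f_min.
have f_anti i : (f i.+1 <= f i)%N.
  apply/f_min/forallP => c; apply/implyP => /andP [/eqP row_c le_c].
  have lt_c : (cell_col c < rowlen la i)%N.
    by apply: leq_trans (cell_col_lt c) (rowlen_anti _ _); rewrite row_c.
  have [_ /(_ _)[|le_T _]] := ss (cell_at lt_c) c.
    by rewrite /above cell_col_at cell_row_at row_c eqxx ltnSn.
  apply: leq_trans le_T; have /forallP /(_ (cell_at lt_c)) /implyP := f_P i.
  by apply; rewrite cell_col_at cell_row_at eqxx le_c.
pose mu := mkpart f (size la).
have row_mu i : rowlen mu i = f i.
  apply: rowlen_mkpart => //; apply/eqP; rewrite -leqn0.
  by rewrite (leq_trans (f_la _)) // rowlen_eq0.
exists mu => [|i]; last by rewrite row_mu.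
apply/forallP => c; rewrite /inner row_mu; apply/eqP; apply/idP/idP => [|lt_f].
  apply: contraTT; rewrite -!leqNgt => le_f.
  by have /forallP /(_ c) /implyP := f_P (cell_row c); apply; rewrite eqxx.
have : ~~ P (cell_row c) (cell_col c).
  by apply: contraTN lt_f => /f_min; rewrite -leqNgt.
case/forallPn => d; rewrite negb_imply -ltnNge => /andP [/andP [/eqP row_d le_d]].
move: le_d; rewrite leq_eqVlt => /orP [/eqP eq_d|lt_d].
  by rewrite (cell_inj (esym row_d) eq_d).
have /(proj1 (ss c d)) [le_T _] : left_of c d by rewrite /left_of row_d eqxx.
exact: leq_ltn_trans.
Qed.

(** All cells outside [mu] carry the letter [p]. Two of them in one column are excluded if [p] is
    unprimed, two in one row if it is primed. *)
Lemma fits_strip la p mu (T : filling la N) : hook_ss T ->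
  letters_below p.+1 T -> (forall i, (rowlen mu i <= rowlen la i)%N) ->
  fits p mu T -> strip (k <= p)%N mu la.
Proof.
move=> /hook_ssP ss /forallP ltp sub /forallP fit.
have Tp (c : cell la) : ~~ inner mu c -> T c = p :> nat.
  have /eqP <- := fit c; have := ltp c; lia.
apply/stripP => i; split=> //; case: ltnP => le_k; rewrite leqNgt; apply/negP => h.
  have lt_i := leq_trans h (rowlen_anti la (leqnSn i)).
  have Tc : T (cell_at lt_i) = p :> nat.
    by apply: Tp; rewrite /inner cell_col_at cell_row_at ltnn.
  have Td : T (cell_at h) = p :> nat.
    by apply: Tp; rewrite /inner cell_col_at cell_row_at -leqNgt rowlen_anti.
  have /(proj2 (ss (cell_at lt_i) (cell_at h))) [_ bad] :
    above (cell_at lt_i) (cell_at h).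
    by rewrite /above !(cell_col_at, cell_row_at) eqxx ltnSn.
  by have := bad (val_inj (etrans Tc (esym Td))); rewrite Tc leqNgt le_k.
have lt_i := ltnW h.
have Tc : T (cell_at lt_i) = p :> nat.
  by apply: Tp; rewrite /inner cell_col_at cell_row_at ltnn.
have Td : T (cell_at h) = p :> nat.
  by apply: Tp; rewrite /inner cell_col_at cell_row_at -leqNgt leqnSn.
have /(proj1 (ss (cell_at lt_i) (cell_at h))) [_ bad] :
  left_of (cell_at lt_i) (cell_at h).
  by rewrite /left_of !(cell_col_at, cell_row_at) eqxx ltnSn.
by have := bad (val_inj (etrans Tc (esym Td))); rewrite Tc ltnNge le_k.
Qed.

Lemma fits_uniq la p mu nu (T : filling la N) :
  (forall i, (rowlen mu i <= rowlen la i)%N) ->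
  (forall i, (rowlen nu i <= rowlen la i)%N) ->
  fits p mu T -> fits p nu T -> mu = nu.
Proof.
move=> submu subnu /forallP fmu /forallP fnu; apply: intpart_eqP => i.
apply/eq_ltn => j; have [lt_j|ge_j] := ltnP j (rowlen la i); last first.
  by rewrite !ltnNge !(leq_trans _ ge_j).
by have /eqP := fmu (cell_at lt_j); have /eqP -> := fnu (cell_at lt_j).
Qed.

(** The tableaux on the left arise uniquely from tableaux of shape [mu] by writing [p] in every
    outer cell. The strip condition is what makes these repetitions of [p] legal. *)
Lemma tableau_sum_strip la p mu : (p < N)%N -> strip (k <= p)%N mu la ->
  \sum_(T : filling la N | [&& hook_ss T, letters_below p.+1 T & fits p mu T])
    \prod_c x (T c) = x p ^+ (weight la - weight mu) * tableau_sum mu p.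
Proof.
move=> lt_p st; have sub := strip_rowlen st.
pose ext (T : filling mu N) : filling la N :=
  [ffun c => if retr mu c is Some d then T d else Ordinal lt_p].
pose res (T : filling la N) : filling mu N := [ffun d => T (emb sub d)].
have ext_in T d : ext T (emb sub d) = T d by rewrite ffunE retr_emb.
have ext_out T c : ~~ inner mu c -> ext T c = Ordinal lt_p.
  by move=> out; rewrite ffunE retr_outer.
have inout c : (exists d, c = emb sub d) \/ ~~ inner mu c.
  by case: (boolP (inner mu c)) => [/(innerP sub)|]; [left | right].
rewrite mulr_sumr (reindex_onto ext res) => [|T /and3P [_ /forallP ltp /forallP fit]].
  apply: eq_big => [T|T _]; last first.
    rewrite (bigID (@inner mu la)) /= (prod_inner sub) mulrC; congr (_ * _).
      rewrite -(card_outer sub) -prodr_const; apply: eq_bigr => c out.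
      by rewrite ext_out.
    by apply: eq_bigr => d _; rewrite ext_in.
  have -> : res (ext T) == T by apply/eqP/ffunP => d; rewrite ffunE ext_in.
  rewrite andbT; apply/and3P/andP => [[/hook_ssP ss _ /forallP fit]|].
    split.
      apply/hook_ssP => c d; have := ss (emb sub c) (emb sub d).
      by rewrite !ext_in.
    by apply/forallP => d; have /eqP := fit (emb sub d); rewrite ext_in inner_emb.
  case=> /hook_ssP ss /forallP ltp.
  have ext_lt d : (ext T (emb sub d) < p)%N by rewrite ext_in ltp.
  move/stripP: (st) => st'.
  split.
  - apply/hook_ssP => c d.
    case: (inout c) => [[c' ->]|outc]; case: (inout d) => [[d' ->]|outd].
    + by rewrite !ext_in; apply: ss.
    + have := ext_lt c'; rewrite (ext_out _ _ outd) => lt.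
      by split=> _; split=> [|eq_p]; rewrite ?(ltnW lt) //; move: lt; rewrite eq_p ltnn.
    + have := inner_emb sub d'; move: outc; rewrite /inner -leqNgt => h1 h2.
      split=> /andP [/eqP h3 h4]; exfalso; move: h1 h2; first by rewrite h3; lia.
      by have := rowlen_anti mu (ltnW h4); lia.
    rewrite !ext_out //=; move: outc outd; rewrite /inner -!leqNgt => h1 h2.
    have lt_c := cell_col_lt c; have lt_d := cell_col_lt d.
    split=> /andP [/eqP h3 h4]; split=> // _; move: (st' (cell_row c)) => [_].
      by case: leqP => // _; rewrite h3 in lt_c h1 *; lia.
    case: leqP => // _; have := rowlen_anti la h4; lia.
  - apply/forallP => c; case: (inout c) => [[c' ->]|outc].
      exact: leqW (ext_lt c').
    by rewrite ext_out //=.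
  apply/forallP => c; case: (inout c) => [[c' ->]|outc].
    by rewrite inner_emb ext_lt.
  by rewrite ext_out //= ltnn (negPf outc).
apply/ffunP => c; case: (inout c) => [[c' ->]|outc].
  by rewrite ext_in ffunE.
rewrite ext_out //; apply: val_inj; apply/eqP; rewrite eqn_leq /=.
have /eqP := fit c; rewrite (negPf outc) [(p <= _)%N]leqNgt => -> /=.
exact: ltp.
Qed.

Lemma tableau_sumS la p : (p < N)%N -> tableau_sum la p.+1 =
  \sum_(mu <- ptsle (weight la) | strip (k <= p)%N mu la)
    x p ^+ (weight la - weight mu) * tableau_sum mu p.
Proof.
move=> lt_p.
transitivity (\sum_(T : filling la N | hook_ss T && letters_below p.+1 T)
  \sum_(mu <- ptsle (weight la) | strip (k <= p)%N mu la && fits p mu T)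
    \prod_c x (T c)).
  apply: eq_bigr => T /andP [ss ltp]; have [mu fit sub] := fits_exists p ss.
  have st := fits_strip ss ltp sub fit.
  rewrite (eq_big_uniq [:: mu] xpredT) ?uniq_ptsle ?big_seq1 // => nu.
  rewrite mem_ptsle inE andbT; apply/and3P/eqP => [[_ st' fit']|->].
    exact: fits_uniq (strip_rowlen st') sub fit' fit.
  by split=> //; apply: strip_weight st.
rewrite (exchange_big_dep (fun mu => strip (k <= p)%N mu la)) /=; last first.
  by move=> T mu _ /andP [].
apply: eq_bigr => mu st; rewrite -tableau_sum_strip //.
by apply: eq_bigl => T; rewrite st /= andbA.
Qed.

Definition word (p : nat) : seq (bool * R) :=
  [seq ((k <= i)%N, x i) | i <- rev (iota 0 p)].

Lemma wordS p : word p.+1 = ((k <= p)%N, x p) :: word p.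
Proof. by rewrite /word -addn1 iotaD rev_cat. Qed.

Lemma tableau_sumE la p : (p <= N)%N -> tableau_sum la p = super_schur (word p) la.
Proof.
elim: p la => [|p IH] la le_p; last first.
  rewrite tableau_sumS // wordS /=; apply: eq_bigr => mu _.
  by rewrite IH // ltnW.
rewrite /tableau_sum /=; case: eqP => [->|ne].
  have no_cell (c : cell part0) : False by have := cell_col_lt c; rewrite rowlen_part0.
  rewrite (big_pred1 [ffun c => False_rect 'I_N (no_cell c)]) => [|T].
    by rewrite big1 // => c; case: (no_cell c).
  apply/andP/eqP => [_|_]; first by apply/ffunP => c; case: (no_cell c).
  by split; [apply/hook_ssP => c | apply/forallP => c]; case: (no_cell c).
rewrite big_pred0 // => T; apply/negP => /andP [_ /forallP h]; apply: ne.
apply: intpart_eqP => i; rewrite rowlen_part0; apply/eqP; rewrite -leqn0 leqNgt.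
by apply/negP => lt_i; have := h (cell_at lt_i).
Qed.

End TableauBranching.

(** Indexing by [nat] lets words be built from [iota]; the value 0 is taken only outside the range
    of the variables. *)
Definition mvar n (i : nat) : {mpoly rat[n]} := if insub i is Some j then 'X_j else 0.

Lemma hook_schur_polyE la k l :
  hook_schur_poly la k l = super_schur (word k (mvar (k + l)) (k + l)) la.
Proof.
rewrite -(@tableau_sumE _ k (k + l)) //; apply: eq_big => T.
  by rewrite (_ : letters_below _ _ = true) ?andbT //; apply/forallP => c.
by move=> _; apply: eq_bigr => c _; rewrite /mvar valK.
Qed.

(** With [k = n] no letter is primed, and the hook conditions reduce to those of an ordinary
    semistandard tableau. *)
Lemma schur_polyE la n :
  schur_poly la n = super_schur (word n (mvar n) n) la.
Proof.
rewrite -(@tableau_sumE _ n n) //; apply: eq_big => T.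
  rewrite (_ : letters_below _ _ = true) ?andbT; last by apply/forallP => c.
  apply: eq_forallb => c; apply: eq_forallb => d; congr (_ && _).
    by rewrite ltn_ord implybT andbT.
  congr (_ ==> _); rewrite (leqNgt n) ltn_ord implybF ltn_neqAle andbC.
  by congr (_ && _).
by move=> _; apply: eq_bigr => c _; rewrite /mvar valK.
Qed.

(** * Coefficients *)

Lemma mcoeffXM n (R : comNzRingType) (p : {mpoly R[n]}) m m' :
  ('X_[m] * p)@_m' = if (m <= m')%MM then p@_(m' - m) else 0.
Proof.
rewrite mulrC; case: ifP => [/submK {1}<-|nle]; first by rewrite addmC mcoeffMX.
rewrite mcoeffM big1 // => -[k1 k2] /= /eqP eq_m.
rewrite mcoeffX; case: eqP => [eq_k|]; rewrite ?mulr0 //.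
case/negP: nle; rewrite eq_m eq_k; apply/mnm_lepP => i.
by rewrite mnmDE leq_addl.
Qed.

Definition mseq n (m : 'X_{1..n}) : seq nat := [seq m i | i <- enum 'I_n].

Lemma size_mseq n (m : 'X_{1..n}) : size (mseq m) = n.
Proof. by rewrite size_map size_enum_ord. Qed.

Lemma nth_mseq n (m : 'X_{1..n}) (i : 'I_n) : nth 0%N (mseq m) i = m i.
Proof. by rewrite (nth_map i) ?size_enum_ord // nth_ord_enum. Qed.

Definition mword k (s : seq nat) p : seq (bool * nat) :=
  [seq ((k <= i)%N, nth 0%N s i) | i <- rev (iota 0 p)].

Lemma mwordS k s p : mword k s p.+1 = ((k <= p)%N, nth 0%N s p) :: mword k s p.
Proof. by rewrite /mword -addn1 iotaD rev_cat. Qed.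

Lemma mvarE n (i : 'I_n) : mvar n i = 'X_i.
Proof. by rewrite /mvar valK. Qed.

(** The exponent of the variable [p] prescribes the size of the outermost strip; dividing by that
    power leaves a monomial in the earlier variables. As only the first [p] variables occur, a
    monomial that involves a later one has coefficient 0. *)
Lemma mcoeff_super_schur n k p (m : 'X_{1..n}) la : (p <= n)%N ->
  (super_schur (word k (mvar n) p) la)@_m =
  (if [forall i : 'I_n, (p <= i)%N ==> (m i == 0%N)]
   then chains (mword k (mseq m) p) la else 0)%:R.
Proof.
elim: p m la => [|p IH] m la le_p.
  rewrite /= mcoeffMn mcoeff1.
  have -> : [forall i : 'I_n, (0 <= i)%N ==> (m i == 0%N)] = (m == 0%MM).
    apply/forallP/eqP => [h|-> i]; last by rewrite mnm0E.
    by apply/mnmP => i; rewrite mnm0E; apply/eqP/h.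
  by case: (m == _); case: (la == _).
rewrite wordS mwordS /= raddf_sum /=; pose i0 := Ordinal le_p.
set A := [forall i, _]; pose e mu := (weight la - weight mu)%N.
transitivity (\sum_(mu <- ptsle (weight la) | strip (k <= p)%N mu la)
  (if A && (weight la == weight mu + nth 0 (mseq m) p)%N
   then chains (mword k (mseq m) p) mu else 0)%:R : rat); last first.
  case: A => /=; last by rewrite big1.
  by rewrite natr_sum big_mkcondr /=; apply: eq_bigr => mu _; case: ifP.
apply: eq_bigr => mu st; have wmu := strip_weight st.
rewrite (mvarE i0 : mvar n p = _) mpolyXn mcoeffXM.
rewrite (nth_mseq m i0 : nth 0%N _ p = _).
have -> : (U_(i0) *+ (weight la - weight mu) <= m)%MM =
    (weight la - weight mu <= m i0)%N.
  apply/mnm_lepP/idP => [/(_ i0)|h i]; rewrite mulmnE mnm1E ?eqxx ?mul1n //.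
  by case: eqP => [<-|]; rewrite ?mul1n ?mul0n.
case: leqP => h; last first.
  by case: eqP => h'; rewrite ?andbF //; exfalso; lia.
rewrite IH; last exact: ltnW.
set m' := (m - _)%MM.
have m'E i : m' i = (m i - (i0 == i) * (weight la - weight mu))%N.
  by rewrite mnmBE mulmnE mnm1E.
have -> : [forall i : 'I_n, (p <= i)%N ==> (m' i == 0%N)] =
    A && (weight la == weight mu + m i0)%N.
  apply/forallP/andP => [h1|[/forallP h1 h2] i].
    split.
      apply/forallP => i; apply/implyP => lt_i; move: (h1 i).
      rewrite (ltnW lt_i) m'E; have [eq_i|_] := eqVneq i0 i.
        by rewrite -eq_i /= ltnn in lt_i.
      by rewrite mul0n subn0.
    by move: (h1 i0); rewrite leqnn m'E eqxx mul1n /=; lia.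
  apply/implyP; rewrite leq_eqVlt => /orP [eq_i|lt_i]; rewrite m'E.
    have -> : i0 == i by rewrite -val_eqE.
    by rewrite -(_ : i0 = i) ?mul1n; [lia | apply: val_inj; apply/eqP].
  by have := h1 i; rewrite lt_i /= => /eqP ->; rewrite sub0n.
congr (if _ then _ else _)%:R; congr (chains _ _).
apply/eq_in_map => i; rewrite mem_rev mem_iota /= add0n => lt_i.
have lt_n : (i < n)%N by apply: leq_trans lt_i (ltnW le_p).
rewrite (nth_mseq m' (Ordinal lt_n) : nth 0%N _ i = _).
rewrite (nth_mseq m (Ordinal lt_n) : nth 0%N _ i = _) m'E.
rewrite -val_eqE /=; case: eqP => [eq_i|]; last by rewrite mul0n subn0.
by rewrite eq_i ltnn in lt_i.
Qed.

Definition eword (s : seq nat) : seq (bool * nat) := [seq (true, k) | k <- rev s].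

(** The unprimed letters are the smaller ones, so their strips are innermost and stand at the end of
    the word. *)
Lemma mword_split k s p : size s = p ->
  mword k s p = eword (drop k s) ++ hword (take k s).
Proof.
move=> sz; rewrite /mword /eword /hword !map_rev -rev_cat; congr rev.
apply: (@eq_from_nth _ (false, 0%N)).
  by rewrite size_map size_iota size_cat !size_map -size_cat cat_take_drop.
rewrite size_map size_iota => i lt_i.
rewrite (nth_map 0%N) ?size_iota // nth_iota // add0n nth_cat size_map.
rewrite size_take sz; case: (ltnP k p) => h.
  case: (ltnP i k) => h'.
    by rewrite (nth_map 0%N) ?size_take ?sz ?h // nth_take // leqNgt h'.
  by rewrite (nth_map 0%N) ?size_drop ?sz ?ltn_sub2r // nth_drop subnKC.
by rewrite lt_i (nth_map 0%N) ?take_oversize ?sz // leqNgt (leq_trans lt_i h).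
Qed.

Lemma mcoeff_hook_schur la k l (m : 'X_{1..k + l}) :
  (hook_schur_poly la k l)@_m =
  (chains (eword (drop k (mseq m)) ++ hword (take k (mseq m))) la)%:R.
Proof.
rewrite hook_schur_polyE mcoeff_super_schur // mword_split ?size_mseq //.
by case: ifP => // /forallP []; move=> i; rewrite leqNgt ltn_ord.
Qed.

Lemma mcoeff_schur la n (m : 'X_{1..n}) :
  (schur_poly la n)@_m = (chains (hword (mseq m)) la)%:R.
Proof.
rewrite schur_polyE mcoeff_super_schur // mword_split ?size_mseq //.
rewrite drop_oversize ?take_oversize ?size_mseq //=.
by case: ifP => // /forallP []; move=> i; rewrite leqNgt ltn_ord.
Qed.

Definition mnm_of_seq n (s : seq nat) : 'X_{1..n} := [multinom nth 0%N s i | i < n].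

Lemma mseqK n (s : seq nat) : size s = n -> mseq (mnm_of_seq n s) = s.
Proof.
move=> sz; apply: (@eq_from_nth _ 0%N); rewrite size_mseq // => i lt_i.
by rewrite (nth_mseq _ (Ordinal lt_i) : nth 0%N _ i = _) mnmE.
Qed.

Lemma mnm_of_seqK n (m : 'X_{1..n}) : mnm_of_seq n (mseq m) = m.
Proof. by apply/mnmP => i; rewrite mnmE nth_mseq. Qed.

Lemma schur_polyE_seq la n :
  schur_poly la n = seq_schur [seq 'X_i | i <- rev (enum 'I_n)] la.
Proof.
rewrite schur_polyE /seq_schur; congr (super_schur _ _).
rewrite /word -val_enum_ord -map_rev -!map_comp; apply: eq_map => i /=.
by rewrite leqNgt ltn_ord mvarE.
Qed.

Lemma mdeg_mseq n (m : 'X_{1..n}) : mdeg m = sumn (mseq m).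
Proof. by rewrite mdegE sumnE big_map big_enum. Qed.

Lemma schur_symmetric la n : schur_poly la n \is symmetric.
Proof.
apply/issymP => s; rewrite schur_polyE_seq seq_schur_morph.
apply: seq_schur_perm; rewrite -map_comp.
rewrite [X in perm_eq X _](_ : _ =
  [seq 'X_i | i : 'I_n <- [seq s i | i <- rev (enum 'I_n)]]).
  apply: perm_map.
  apply: uniq_perm; rewrite ?(map_inj_uniq perm_inj) ?rev_uniq ?enum_uniq // => i.
  rewrite mem_rev mem_enum; apply/mapP; exists (s^-1 i)%g; rewrite ?mem_rev ?mem_enum //.
  by rewrite permKV.
rewrite -map_comp; apply: eq_map => i /=; rewrite msymX; congr 'X_[_].
apply/mnmP => j; rewrite mnmE !mnm1E.
by rewrite -(inj_eq (@perm_inj _ s)) permKV.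
Qed.

(** The last variable heads the reversed list, so that setting it to 0 is the situation of
    [seq_schur0]. *)
Lemma kill_last_schur la n : kill_last (schur_poly la n.+1) = schur_poly la n.
Proof.
rewrite /kill_last !schur_polyE_seq.
set t := [tuple _ | _ < _].
rewrite (seq_schur_morph (comp_mpoly t)).
have t_widen (i : 'I_n) : t`_(val (fintype.lift ord_max i)) = 'X_i.
  by rewrite -tnth_nth tnth_mktuple liftK.
rewrite [X in seq_schur X _](_ : _ =
    0 :: [seq 'X_i : {mpoly rat[n]} | i <- rev (enum 'I_n)]).
  exact: seq_schur0.
  rewrite enum_ordSr rev_rcons !map_cons /= comp_mpolyXU -tnth_nth tnth_mktuple.
  rewrite unlift_none -map_rev -!map_comp; congr (_ :: _); apply: eq_map => i /=.
  by rewrite comp_mpolyXU -t_widen; congr (t`_ _); rewrite /= /bump leqNgt ltn_ord.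
Qed.

Lemma schur_symfun la : symfun (schur la).
Proof.
split; [exact: schur_symmetric | exact: kill_last_schur |].
exists (weight la).+1 => n; rewrite msizeE; apply/bigmax_leqP_seq => m m_supp _.
rewrite ltnS; move: m_supp; rewrite mcoeff_msupp mcoeff_schur.
rewrite Num.Theory.pnatr_eq0 => /chains_wsize ->; by rewrite wsize_hword mdeg_mseq.
Qed.

(** * Schur expansions *)

Lemma big_dom (V : lmodType rat) (m : {freeg intpart / rat}) s (G : intpart -> V) :
  uniq s -> {subset dom m <= s} ->
  \sum_(la <- dom m) coeff la m *: G la = \sum_(la <- s) coeff la m *: G la.
Proof.
move=> us sub; rewrite [RHS](bigID (fun la => la \in dom m)) /=.
rewrite [X in _ + X]big1 ?addr0 => [|la /coeff_outdom ->]; last by rewrite scale0r.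
apply: eq_big_uniq; rewrite ?uniq_dom // => la.
by rewrite andbT andb_idl // => /sub.
Qed.

Definition fg_of (s : seq intpart) (c : intpart -> rat) : {freeg intpart / rat} :=
  \sum_(la <- s) << c la *g la >>.

Lemma coeff_fg_of s c la : uniq s ->
  coeff la (fg_of s c) = if la \in s then c la else 0.
Proof.
move=> us; rewrite raddf_sum /=; under eq_bigr => mu _ do rewrite coeffU.
case: ifPn => h.
  rewrite (bigD1_seq la) //= eqxx mulr1 big1 ?addr0 // => mu ne.
  by rewrite (negPf ne) mulr0.
rewrite big_seq big1 // => mu mu_s; case: eqP => [eq_mu|]; rewrite ?mulr0 //.
by rewrite -eq_mu mu_s in h.
Qed.

Lemma big_dom_fg_of (V : lmodType rat) s c (G : intpart -> V) : uniq s ->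
  \sum_(la <- dom (fg_of s c)) coeff la (fg_of s c) *: G la =
  \sum_(la <- s) c la *: G la.
Proof.
move=> us; rewrite (big_dom _ us) => [|la].
  by rewrite !big_seq; apply: eq_bigr => la la_s; rewrite coeff_fg_of // la_s.
by rewrite mem_dom coeff_fg_of //; case: ifP => //; rewrite eqxx.
Qed.

Definition pairing (m : {freeg intpart / rat}) (F : intpart -> rat) : rat :=
  \sum_(la <- dom m) coeff la m * F la.

Lemma pairing_fg_of s c F : uniq s ->
  pairing (fg_of s c) F = \sum_(la <- s) c la * F la.
Proof. by move=> us; apply: (big_dom_fg_of c (F : intpart -> rat^o) us). Qed.

Lemma eq_pairing m F G : F =1 G -> pairing m F = pairing m G.
Proof. by move=> h; apply: eq_bigr => la _; rewrite h. Qed.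

Lemma pairing_sum m (T : Type) (s : seq T) (c : T -> rat) (F : T -> intpart -> rat) :
  pairing m (fun la => \sum_(t <- s) c t * F t la) =
  \sum_(t <- s) c t * pairing m (F t).
Proof.
rewrite /pairing; under eq_bigr do rewrite mulr_sumr.
rewrite exchange_big; apply: eq_bigr => t _; rewrite mulr_sumr.
by apply: eq_bigr => la _; rewrite mulrCA.
Qed.

Lemma pairing_delta m la : pairing m (fun nu => (nu == la)%:R) = coeff la m.
Proof.
rewrite -[in RHS](freeg_sumE m) raddf_sum; apply: eq_bigr => nu _.
by rewrite /= coeffU.
Qed.

Lemma pairingB m F G :
  pairing m (fun la => F la - G la) = pairing m F - pairing m G.
Proof. by rewrite -sumrB; apply: eq_bigr => la _; rewrite mulrBr. Qed.

Lemma schur_sumE m s n : uniq s -> {subset dom m <= s} ->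
  schur_sum m n = \sum_(la <- s) coeff la m *: schur la n.
Proof. exact: big_dom. Qed.

Lemma schur_sum_fg_of s c n : uniq s ->
  schur_sum (fg_of s c) n = \sum_(la <- s) c la *: schur la n.
Proof. exact: big_dom_fg_of. Qed.

Lemma mcoeff_schur_sum m n (a : 'X_{1..n}) :
  (schur_sum m n)@_a = pairing m (fun la => (chains (hword (mseq a)) la)%:R).
Proof.
rewrite raddf_sum; apply: eq_bigr => la _ /=.
by rewrite mcoeffZ mcoeff_schur.
Qed.

Lemma mcoeff_hook_schur_sum m k l (a : 'X_{1..k + l}) :
  (hook_schur_sum m k l)@_a = pairing m (fun la =>
    (chains (eword (drop k (mseq a)) ++ hword (take k (mseq a))) la)%:R).
Proof.
rewrite raddf_sum; apply: eq_bigr => la _ /=.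
by rewrite mcoeffZ mcoeff_hook_schur.
Qed.

Lemma hword_cat a b : hword (a ++ b) = hword b ++ hword a.
Proof. by rewrite /hword rev_cat map_cat. Qed.

(** Compare the coefficients of the monomials with exponents [a] in the variables X and [b] in the
    variables Y. Since [k] and [l] are arbitrary, [a] and [b] run over all sequences. *)
Lemma hook_schur_sumP m :
  (forall k l, schur_sum m (k + l)%N = hook_schur_sum m k l) <->
  (forall a b, pairing m (fun la => (chains (hword b ++ hword a) la)%:R -
                            (chains (eword b ++ hword a) la)%:R) = 0).
Proof.
split=> [h a b|h k l].
  rewrite pairingB; have := congr1 (mcoeff (mnm_of_seq _ (a ++ b))) (h (size a) (size b)).
  rewrite mcoeff_schur_sum mcoeff_hook_schur_sum mseqK ?size_cat //.
  by rewrite take_size_cat // drop_size_cat // hword_cat => ->; rewrite subrr.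
apply/mpolyP => m'; rewrite mcoeff_schur_sum mcoeff_hook_schur_sum.
apply/eqP; rewrite -subr_eq0 -pairingB.
by rewrite -{1}(cat_take_drop k (mseq m')) hword_cat h.
Qed.

(** [T] is a row of the inverse Kostka matrix: the coefficients of S_la in the products of the h_k.
    For [nu] of another weight both sides are 0, which is why [nu] is unrestricted. *)
Lemma delta_chains la : exists T : intpart -> rat, forall nu,
  (nu == la)%:R = \sum_(al <- pts (weight la)) T al * (chains (hword al) nu)%:R.
Proof.
set d := weight la; set s := pts d.
have Ku := chain_mx_unit d; set K := chain_mx d in Ku.
have la_s : (index la s < size s)%N by rewrite index_mem mem_pts.
pose i := Ordinal la_s.
exists (fun al => if insub (index al s) is Some j then invmx K i j else 0) => nu.
rewrite (big_nth part0) big_mkord.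
have us : uniq s := uniq_pts d.
transitivity (\sum_j invmx K i j * (chains (hword (nth part0 s j)) nu)%:R); last first.
  by apply: eq_bigr => j _; rewrite index_uniq // valK.
have [nu_s|nu_s] := boolP (nu \in s); last first.
  rewrite big1 => [|j _].
    by case: eqP nu_s => // ->; rewrite mem_pts eqxx.
  have [->|/chains_wsize] := eqVneq (chains (hword (nth part0 s j)) nu) 0%N.
    by rewrite mulr0.
  rewrite wsize_hword => wnu; case/negP: nu_s.
  by have := mem_nth part0 (ltn_ord j); rewrite !mem_pts wnu.
have nu_i : (index nu s < size s)%N by rewrite index_mem.
have := congr1 (fun A : 'M_(size s) => A i (Ordinal nu_i)) (mulVmx Ku).
rewrite !mxE /= => eq_K.
have -> : (nu == la) = (i == Ordinal nu_i).
  rewrite -[RHS]val_eqE /=; apply/eqP/eqP => [->//|eq_ind].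
  by rewrite -(nth_index part0 nu_s) -eq_ind nth_index // mem_pts.
by rewrite -eq_K; apply: eq_bigr => j _; rewrite mxE /= nth_index.
Qed.

(** The Kostka system in the other direction: Schur coordinates with prescribed coefficients at the
    monomials x^al. *)
Lemma chains_solve d (F : intpart -> rat) : exists c : intpart -> rat,
  forall al, weight al = d ->
    \sum_(la <- pts d) c la * (chains (hword al) la)%:R = F al.
Proof.
set s := pts d; have Ku := chain_mx_unit d; set K := chain_mx d in Ku.
have us : uniq s := uniq_pts d.
pose v := invmx K *m \col_i F (nth part0 s i).
exists (fun la => if insub (index la s) is Some j then v j 0 else 0) => al wal.
have al_s : al \in s by rewrite mem_pts wal.
have al_i : (index al s < size s)%N by rewrite index_mem.
have := congr1 (fun A : 'cV_(size s) => A (Ordinal al_i) 0)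
  (mulKVmx Ku (\col_i F (nth part0 s i))).
rewrite !mxE /= nth_index // => <-.
rewrite (big_nth part0) big_mkord; apply: eq_bigr => j _.
by rewrite index_uniq // valK !mxE /= nth_index // mulrC.
Qed.

(** The coordinate at [la] is a fixed combination, by [delta_chains], of coefficients of monomials
    x^al, each read off in [size al] variables. *)
Lemma schur_sum_inj : injective schur_sum.
Proof.
move=> m m' eq_m; apply/eqP/freeg_eqP => la.
have [T hT] := delta_chains la.
rewrite -!pairing_delta !(eq_pairing _ hT) !pairing_sum.
apply: eq_bigr => al _; congr (_ * _).
have := congr1 (fun f : polyfam => (f (size al))@_(mnm_of_seq _ al)) eq_m.
by rewrite !mcoeff_schur_sum mseqK.
Qed.

Lemma schur_coords_sum m : schur_coords (schur_sum m) = m.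
Proof.
have : exists m', schur_sum m = schur_sum m' by exists m.
by rewrite /schur_coords => /(epsilon_spec (inhabits 0)) /schur_sum_inj {2}->.
Qed.

Lemma hall_schur_sum m m' :
  hall (schur_sum m) (schur_sum m') = pairing m (fun la => coeff la m').
Proof. by rewrite /hall !schur_coords_sum. Qed.

(** * Closure properties of symmetric functions *)

Lemma symfun0 : symfun (fun n => 0).
Proof.
split=> [n|n|]; first exact: rpred0.
  by rewrite /kill_last comp_mpoly0.
by exists 0%N => n; rewrite msize0.
Qed.

Lemma symfunD f g : symfun f -> symfun g -> symfun (fun n => f n + g n).
Proof.
move=> [fs fk [d fd]] [gs gk [e ge]]; split=> [n|n|].
- exact: (rpredD (fs n) (gs n)).
- by rewrite /kill_last comp_mpolyD -[X in X + _]/(kill_last _) fk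
    -[X in _ + X]/(kill_last _) gk.
exists (maxn d e) => n; rewrite (leq_trans (msizeD_le _ _)) //.
by rewrite geq_max !leq_max fd ge orbT.
Qed.

Lemma symfunZ (c : rat) f : symfun f -> symfun (fun n => c *: f n).
Proof.
move=> [fs fk [d fd]]; split=> [n|n|].
- exact: (rpredZ _ (fs n)).
- by rewrite /kill_last comp_mpolyZ -[X in _ *: X]/(kill_last _) fk.
by exists d => n; apply: leq_trans (msizeZ_le _ _) (fd n).
Qed.

Lemma symfunM f g : symfun f -> symfun g -> symfun (fun n => f n * g n).
Proof.
move=> [fs fk [d fd]] [gs gk [e ge]]; split=> [n|n|].
- exact: (rpredM (fs n) (gs n)).
- by rewrite /kill_last rmorphM /= -[X in X * _]/(kill_last _) fk
    -[X in _ * X]/(kill_last _) gk.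
exists (d + e).+1 => n; rewrite (leq_trans (msizeM_le _ _)) //.
by rewrite ltnS leq_add.
Qed.

Lemma symfun_sum (T : Type) (s : seq T) (f : T -> polyfam) :
  (forall t, symfun (f t)) -> symfun (fun n => \sum_(t <- s) f t n).
Proof.
move=> hf; elim: s => [|t s IH].
  rewrite (_ : (fun n => _) = (fun n => 0)); first exact: symfun0.
  by apply: functional_extensionality_dep => n; rewrite big_nil.
rewrite (_ : (fun n => _) = (fun n => f t n + \sum_(t <- s) f t n)).
  exact: symfunD.
by apply: functional_extensionality_dep => n; rewrite big_cons.
Qed.

Lemma symfun_schur_sum m : symfun (schur_sum m).
Proof. by apply: symfun_sum => la; apply/symfunZ/schur_symfun. Qed.

(** * Symmetric functions are spanned by Schur functions *)

Lemma mulmx_trmx_eq0 N (u : 'rV[rat]_N) : u *m u^T = 0 -> u = 0.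
Proof.
move=> h; apply/rowP => j; rewrite mxE.
have /eqP := congr1 (fun A : 'M_1 => A 0 0) h; rewrite !mxE /=.
rewrite Num.Theory.psumr_eq0 => [/allP /(_ j)|i _]; last first.
  by rewrite mxE -expr2 Num.Theory.sqr_ge0.
by rewrite mem_index_enum mxE mulf_eq0 orbb => /(_ isT) /eqP.
Qed.

(** [J] is a subspace given only as a proposition. A basis is obtained classically, as a row-free
    matrix of maximal height among those whose row space lies in [J]; then [v] is projected on that
    row space. *)
Lemma orthogonal_decomposition N (J : 'rV[rat]_N -> Prop) :
  J 0 -> (forall a u v, J u -> J v -> J (a *: u + v)) ->
  forall v, exists u w,
    [/\ v = u + w, J w & forall j, J j -> u *m j^T = 0].
Proof.
move=> J0 JD v.
have JZ a u : J u -> J (a *: u) by move=> Ju; rewrite -[_ *: _]addr0; apply: JD.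
pose Q k := exists A : 'M[rat]_(k, N),
  row_free A /\ forall u : 'rV_N, (u <= A)%MS -> J u.
pose P k := if excluded_middle_informative (Q k) then true else false.
have PQ k : reflect (Q k) (P k).
  by rewrite /P; case: excluded_middle_informative => h; constructor.
have exP : exists k, P k.
  exists 0%N; apply/PQ; exists 0; split=> [|u].
    by rewrite /row_free mxrank0.
  by move/submx0null ->.
have ubP k : P k -> (k <= N)%N.
  by case/PQ => A [+ _] => /eqP {1}<-; apply: rank_leq_col.
case: (ex_maxnP exP ubP) => k /PQ [A [Afree AJ]] maxk.
(* A vector of [J] outside the row space could be appended to [A], against the maximality of [k]. *)
have JA j : J j -> (j <= A)%MS.
  move=> Jj; apply: contraT => nle; have /maxk : P (1 + k)%N; last by rewrite ltnn.
  apply/PQ; exists (col_mx j A); split=> [|u].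
    have lt_A : (A < j + A)%MS.
      by rewrite ltmxE addsmxSr; apply: contra nle; rewrite addsmx_sub => /andP [].
    rewrite /row_free eqn_leq rank_leq_row /= -addsmxE.
    by move: lt_A; rewrite ltmxErank (eqP Afree) => /andP [_]; rewrite -add1n.
  rewrite -addsmxE => /sub_addsmxP [[x y] /= ->].
  rewrite (mx11_scalar x) mul_scalar_mx; apply: JD => //.
  by apply: AJ; apply: submxMl.
pose G := A *m A^T.
have Gu : G \in unitmx.
  rewrite -row_free_unit; apply: inj_row_free => x; rewrite mulmxA => h.
  apply/eqP; rewrite -(mulmx_free_eq0 x Afree); apply/eqP/mulmx_trmx_eq0.
  by rewrite trmx_mul mulmxA h mul0mx.
(* The orthogonal projection of [v]. The Gram matrix [G] is invertible because the form is definite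
   over the rationals. *)
pose w := v *m A^T *m invmx G *m A.
exists (v - w), w; split; first by rewrite subrK.
  by apply: AJ; apply: submxMl.
move=> j /JA /submxP [x ->]; rewrite trmx_mul mulmxA mulmxBl.
by rewrite /w -[X in _ - X]mulmxA mulmxKV // subrr mul0mx.
Qed.

Lemma mcoeff_kill_last n (p : {mpoly rat[n.+1]}) (a : 'X_{1..n.+1}) :
  a ord_max = 0%N ->
  (kill_last p)@_[multinom a (widen_ord (leqnSn n) i) | i < n] = p@_a.
Proof.
move=> a0; rewrite /kill_last; set a' := [multinom _ | _ < _].
set t := [tuple _ | _ < _].
have t_max : tnth t ord_max = 0 by rewrite tnth_mktuple unlift_none.
have t_widen i : tnth t (widen_ord (leqnSn n) i) = 'X_i.
  rewrite tnth_mktuple (_ : widen_ord _ i = fintype.lift ord_max i) ?liftK //.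
  by apply: val_inj; rewrite /= /bump leqNgt ltn_ord.
have mon m : ('X_[m] \mPo t)@_a' = (m == a)%:R.
  rewrite comp_mpolyX big_ord_recr /= t_max.
  under eq_bigr do rewrite t_widen.
  rewrite expr0n; have [m0|m_gt0] := posnP (m ord_max); last first.
    rewrite mulr0 mcoeff0; case: eqP => // eq_m.
    by rewrite eq_m a0 in m_gt0.
  rewrite mulr1; have -> : \prod_(i < n) 'X_i ^+ m (widen_ord (leqnSn n) i) =
     'X_[[multinom m (widen_ord (leqnSn n) i) | i < n]] :> {mpoly rat[n]}.
    by rewrite mpolyXE_id; apply: eq_bigr => i _; rewrite mnmE.
  rewrite mcoeffX; congr (_ %:R); congr nat_of_bool.
  apply/eqP/eqP => [/mnmP h|->] //; apply/mnmP => i.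
  case: (unliftP ord_max i) => [j ->|->]; last by rewrite m0 a0.
  have := h j; rewrite !mnmE (_ : widen_ord _ j = fintype.lift ord_max j) //.
  by apply: val_inj; rewrite /= /bump leqNgt ltn_ord.
rewrite comp_mpolyEX raddf_sum /=.
under eq_bigr do rewrite mcoeffZ mon.
have [a_p|a_p] := boolP (a \in msupp p).
  rewrite (bigD1_seq a) ?msupp_uniq //= eqxx mulr1 big1 ?addr0 // => m ne.
  by rewrite (negPf ne) mulr0.
rewrite (memN_msupp_eq0 a_p) big_seq big1 // => m m_p.
by case: eqP => [eq_m|]; rewrite ?mulr0 // -eq_m m_p in a_p *.
Qed.

(** The leading exponent of a nonzero symmetric polynomial is non-increasing. If its last entry is
    0, the coefficient survives in one variable fewer, where induction applies; otherwise it is a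
    partition with as many parts as variables, and the hypothesis applies. *)
Lemma symfun_eq0 f : symfun f ->
  (forall al : intpart, (f (size al))@_(mnm_of_seq _ al) = 0) ->
  forall n, f n = 0.
Proof.
move=> [fs fk _] f0; elim=> [|n IH].
  apply/mpolyP => a; rewrite mcoeff0 -[RHS](f0 part0); congr _@__.
  by apply/mnmP => -[].
apply/eqP; rewrite -mleadc_eq0; apply: contraTT isT => nz.
have sorted_a := mlead_msym_sorted (fs n.+1).
set a := mlead _ in nz sorted_a.
have anti i j : (i <= j)%N -> (nth 0%N (mseq a) j <= nth 0%N (mseq a) i)%N.
  move=> le_ij; have [lt_j|/(nth_default 0%N)] := ltnP j (size (mseq a)); last by move->.
  rewrite size_mseq in lt_j; have lt_i := leq_ltn_trans le_ij lt_j.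
  rewrite (nth_mseq a (Ordinal lt_j) : nth 0%N _ j = _).
  by rewrite (nth_mseq a (Ordinal lt_i) : nth 0%N _ i = _) sorted_a.
have [last0|last_gt0] := posnP (a ord_max).
  by rewrite -(mcoeff_kill_last _ last0) fk IH mcoeff0 eqxx in nz.
have pa : is_part (mseq a).
  apply/andP; split.
    by apply/(sortedP 0%N) => i _; apply: anti.
  apply/negP => /(nthP 0%N) [i]; rewrite size_mseq => lt_i nth0.
  have := anti i n; rewrite nth0 (nth_mseq a ord_max : nth 0%N _ n = _).
  by move=> /(_ lt_i); rewrite leqNgt last_gt0.
have := f0 (IntPart pa); rewrite /= size_mseq mnm_of_seqK => a0.
by rewrite a0 eqxx in nz.
Qed.

(** * The ideal and its orthogonal complement *)

(** Solve the Kostka system for the coefficients of [f] at the x^al in each weight up to the degree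
    bound [D]. The difference from [f] then satisfies [symfun_eq0]: beyond [D] all coefficients at
    the x^al vanish on both sides. *)
Lemma symfun_schur_sumP f : symfun f -> exists m, f = schur_sum m.
Proof.
move=> sf; have [_ _ [D f_D]] := sf.
pose F al := (f (size al))@_(mnm_of_seq _ al).
pose C d := proj1_sig (constructive_indefinite_description _ (chains_solve d F)).
have CP d al : weight al = d ->
    \sum_(la <- pts d) C d la * (chains (hword al) la)%:R = F al.
  exact: (proj2_sig (constructive_indefinite_description _ (chains_solve d F))).
pose m := fg_of (ptsle D) (fun la => C (weight la) la).
exists m; apply: functional_extensionality_dep => n; apply/eqP.
rewrite -subr_eq0 -scaleN1r; apply/eqP; move: n.
apply: symfun_eq0 => [|al].
  exact: (symfunD sf (symfunZ (-1) (symfun_schur_sum m))).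
rewrite mcoeffD mcoeffZ mulN1r mcoeff_schur_sum mseqK //.
rewrite pairing_fg_of ?uniq_ptsle //.
have [le_D|lt_D] := leqP (weight al) D; last first.
  rewrite [X in _ - X]big_seq big1 ?subr0 => [|la].
    apply: memN_msupp_eq0; apply: msize_mdeg_ge.
    by rewrite mdeg_mseq mseqK // (leq_trans (f_D _)) // ltnW.
  rewrite mem_ptsle => le_la.
  have [->|/chains_wsize] := eqVneq (chains (hword al) la) 0%N.
    by rewrite mulr0.
  by rewrite wsize_hword; lia.
apply/eqP; rewrite subr_eq0 -/(F al) -(CP _ al erefl); apply/eqP.
rewrite [RHS](bigID (fun la => weight la == weight al)) /= [X in _ + X]big1 ?addr0.
  rewrite [RHS](eq_bigr (fun la => C (weight al) la * (chains (hword al) la)%:R)).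
    apply: eq_big_uniq; rewrite ?uniq_pts ?uniq_ptsle // => la.
    by rewrite mem_pts mem_ptsle andbT; case: eqP => [->|]; rewrite ?andbF ?le_D.
  by move=> la /eqP ->.
move=> la ne; have [->|/chains_wsize] := eqVneq (chains (hword al) la) 0%N.
  by rewrite mulr0.
by rewrite wsize_hword => w; rewrite w eqxx in ne.
Qed.

(** * Products of the h_k and e_k, and the ideal *)

Definition chain_fg (w : seq (bool * nat)) : {freeg intpart / rat} :=
  fg_of (pts (wsize w)) (fun la => (chains w la)%:R).

Lemma coeff_chain_fg w la : coeff la (chain_fg w) = (chains w la)%:R.
Proof.
rewrite coeff_fg_of ?uniq_pts // mem_pts; case: ifPn => // ne.
by rewrite chains_weight.
Qed.

Definition vars n : seq {mpoly rat[n]} := [seq 'X_i | i <- rev (enum 'I_n)].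

Lemma schur_sum_chain_fg w n :
  schur_sum (chain_fg w) n = \prod_(p <- w) piece (vars n) p.
Proof.
rewrite prod_pieces schur_sum_fg_of ?uniq_pts //; apply: eq_bigr => la _.
by rewrite /schur schur_polyE_seq scaler_nat mulr_natl.
Qed.

Lemma schur_sum_chain_fg_cat w w' n :
  schur_sum (chain_fg (w ++ w')) n =
  schur_sum (chain_fg w) n * schur_sum (chain_fg w') n.
Proof. by rewrite !schur_sum_chain_fg big_cat. Qed.

Lemma eword_flip s : eword s = [seq (~~ p.1, p.2) | p <- hword s].
Proof. by rewrite /eword /hword -map_comp. Qed.

Lemma conj_ideal_ext f g : (forall n, f n = g n) -> conj_ideal f -> conj_ideal g.
Proof.
move=> h; suff -> : f = g by [].
exact: functional_extensionality_dep.
Qed.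

Lemma conj_ideal_sum (T : Type) (s : seq T) (a : T -> polyfam) (la : T -> intpart) :
  (forall t, symfun (a t)) ->
  conj_ideal (fun n => \sum_(t <- s) a t n *
    (schur (la t) n - schur (conj_part (la t)) n)).
Proof.
move=> sa; exists (size s), (fun i => a (tnth (in_tuple s) i)).
exists (fun i => la (tnth (in_tuple s) i)); split=> [i|]; first exact: sa.
apply: functional_extensionality_dep => n.
by rewrite big_tnth.
Qed.

Lemma conj_idealD f g : conj_ideal f -> conj_ideal g ->
  conj_ideal (fun n => f n + g n).
Proof.
move=> [r [a [la [sa ->]]]] [r' [a' [la' [sa' ->]]]].
pose A (t : 'I_r + 'I_r') := match t with inl i => a i | inr i => a' i end.
pose L (t : 'I_r + 'I_r') := match t with inl i => la i | inr i => la' i end.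
have := @conj_ideal_sum _ (enum {: 'I_r + 'I_r'}) A L.
case=> [[i|i]|k [b [mu [sb eq_b]]]]; [exact: sa | exact: sa' |].
exists k, b, mu; split=> //; rewrite -eq_b.
apply: functional_extensionality_dep => n.
by rewrite big_enum big_sumType.
Qed.

Lemma conj_idealM h f : symfun h -> conj_ideal f -> conj_ideal (fun n => h n * f n).
Proof.
move=> sh [r [a [la [sa ->]]]].
exists r, (fun i n => h n * a i n), la; split=> [i|].
  exact: symfunM.
apply: functional_extensionality_dep => n; rewrite mulr_sumr.
by apply: eq_bigr => i _; rewrite mulrA.
Qed.

Lemma conj_idealZ (c : rat) f : conj_ideal f -> conj_ideal (fun n => c *: f n).
Proof.
move=> [r [a [la [sa ->]]]].
exists r, (fun i n => c *: a i n), la; split=> [i|].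
  exact: symfunZ.
apply: functional_extensionality_dep => n; rewrite scaler_sumr.
by apply: eq_bigr => i _; rewrite scalerAl.
Qed.

Lemma conj_ideal0 : conj_ideal (fun n => 0).
Proof.
apply: (@conj_ideal_ext (fun n => \sum_(t <- ([::] : seq intpart))
  0 * (schur t n - schur (conj_part t) n))) => [n|]; first by rewrite big_nil.
by apply: (@conj_ideal_sum _ _ (fun _ n => 0)) => t; apply: symfun0.
Qed.

Lemma conj_ideal_symfun f : conj_ideal f -> symfun f.
Proof.
move=> [r [a [la [sa ->]]]].
apply: (@symfun_sum _ (index_enum 'I_r)
  (fun i n => a i n * (schur (la i) n - schur (conj_part (la i)) n))) => i.
apply: symfunM => //.
rewrite (_ : (fun n => _) = (fun n => schur (la i) n + -1 *: schur (conj_part (la i)) n)).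
  by apply: symfunD; [|apply: symfunZ]; apply: schur_symfun.
by apply: functional_extensionality_dep => n; rewrite scaleN1r.
Qed.

Lemma schur_sum_eword b n : schur_sum (chain_fg (eword b)) n =
  \sum_(la <- pts (wsize (hword b))) (chains (hword b) la)%:R *: schur (conj_part la) n.
Proof.
have -> : wsize (hword b) = wsize (eword b) by rewrite /wsize -!map_comp.
set s := pts _.
have perm_s : perm_eq s [seq conj_part mu | mu <- s].
  apply: uniq_perm; rewrite ?(map_inj_uniq (inv_inj conj_partK)) ?uniq_pts // => mu.
  rewrite mem_pts; apply/idP/mapP => [h|[nu + ->]].
    by exists (conj_part mu); rewrite ?conj_partK // mem_pts weight_conj.
  by rewrite mem_pts weight_conj.
rewrite schur_sum_fg_of ?uniq_pts // [LHS](perm_big _ perm_s) big_map.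
by apply: eq_bigr => la _; rewrite eword_flip chains_conj conj_partK.
Qed.

(** If h_b is a combination of Schur functions S_la, then e_b is the same combination of the S_la',
    so h_b - e_b is a combination of generators; h_a is the multiplier. *)
Lemma conj_ideal_chains a b : conj_ideal (fun n =>
  schur_sum (chain_fg (hword b ++ hword a)) n -
  schur_sum (chain_fg (eword b ++ hword a)) n).
Proof.
apply: (@conj_ideal_ext (fun n => schur_sum (chain_fg (hword a)) n *
  \sum_(la <- pts (wsize (hword b))) (chains (hword b) la)%:R%:MP *
    (schur la n - schur (conj_part la) n))) => [n|].
  rewrite !schur_sum_chain_fg_cat schur_sum_eword.
  rewrite [schur_sum (chain_fg (hword b)) n]schur_sum_fg_of ?uniq_pts //.
  rewrite -mulrBl mulrC -sumrB; congr (_ * _); apply: eq_bigr => la _.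
  by rewrite mul_mpolyC scalerBr.
apply: conj_idealM; first exact: symfun_schur_sum.
apply: (@conj_ideal_sum _ _ (fun la n => (chains (hword b) la)%:R%:MP)) => la.
split=> [n|n|].
- by rewrite -[_%:MP]mulr1 mul_mpolyC; apply: rpredZ; apply: rpred1.
- by rewrite /kill_last comp_mpolyC.
by exists 1%N => n; rewrite msizeC; case: eqP.
Qed.

(** Orthogonality with an explicit coordinate vector in place of [hall], whose coordinates come from
    [epsilon]; closure under linear combinations becomes a computation with coordinates. *)
Definition perp (m : {freeg intpart / rat}) (f : polyfam) : Prop :=
  exists2 m', f = schur_sum m' & pairing m (fun la => coeff la m') = 0.

Lemma schur_sum_lin (c : rat) m m' n :
  schur_sum (c *: m + m') n = c *: schur_sum m n + schur_sum m' n.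
Proof.
pose s := undup (dom m ++ dom m').
rewrite !(@schur_sumE _ s n) ?undup_uniq //.
- rewrite scaler_sumr -big_split; apply: eq_bigr => la _ /=.
  by rewrite coeffD coeffZ scalerDl scalerA.
- by move=> la la_m; rewrite mem_undup mem_cat la_m orbT.
- by move=> la la_m; rewrite mem_undup mem_cat la_m.
move=> la /domD_subset; rewrite mem_undup !mem_cat => /orP [/domZ_subset|] ->;
  by rewrite ?orbT.
Qed.

Lemma pairing_coeff_lin m (c : rat) m1 m2 :
  pairing m (fun la => coeff la (c *: m1 + m2)) =
  c * pairing m (fun la => coeff la m1) + pairing m (fun la => coeff la m2).
Proof.
rewrite mulr_sumr -big_split; apply: eq_bigr => la _ /=.
by rewrite coeffD coeffZ mulrDr mulrCA.
Qed.

Lemma perp_ext m f g : (forall n, f n = g n) -> perp m f -> perp m g.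
Proof.
move=> h; suff -> : f = g by [].
exact: functional_extensionality_dep.
Qed.

Lemma perp0 m : perp m (fun n => 0).
Proof.
exists 0; last by rewrite /pairing big1 // => la _; rewrite coeff0 mulr0.
by apply: functional_extensionality_dep => n; rewrite /schur_sum dom0 big_nil.
Qed.

Lemma perp_lin m c f g : perp m f -> perp m g -> perp m (fun n => c *: f n + g n).
Proof.
move=> [m1 -> h1] [m2 -> h2]; exists (c *: m1 + m2).
  by apply: functional_extensionality_dep => n; rewrite schur_sum_lin.
by rewrite pairing_coeff_lin h1 h2 mulr0 addr0.
Qed.

Lemma perp_sum m (T : Type) (s : seq T) (c : T -> rat) (f : T -> polyfam) :
  (forall t, perp m (f t)) -> perp m (fun n => \sum_(t <- s) c t *: f t n).
Proof.
move=> h; elim: s => [|t s IH].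
  by apply: perp_ext (perp0 m) => n; rewrite big_nil.
apply: perp_ext (perp_lin (c t) (h t) IH) => n.
by rewrite big_cons.
Qed.

Lemma schur_sum_sum (T : Type) (s : seq T) (c : T -> rat)
    (F : T -> {freeg intpart / rat}) n :
  schur_sum (\sum_(t <- s) c t *: F t) n = \sum_(t <- s) c t *: schur_sum (F t) n.
Proof.
elim: s => [|t s IH]; first by rewrite !big_nil /schur_sum dom0 big_nil.
by rewrite !big_cons schur_sum_lin IH.
Qed.

Lemma schur_sumU la n : schur_sum << la >> n = schur la n.
Proof. by rewrite /schur_sum domU1 big_seq1 coeffU eqxx mulr1 scale1r. Qed.

(** The same coefficients serve for S_la in the h_al and for S_la' in the e_al; this is how
    differences h_b - e_b generate the S_la - S_la'. *)
Lemma schur_chains la (T : intpart -> rat) :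
  (forall nu, (nu == la)%:R =
    \sum_(al <- pts (weight la)) T al * (chains (hword al) nu)%:R) ->
  (forall n, schur la n =
     \sum_(al <- pts (weight la)) T al *: schur_sum (chain_fg (hword al)) n) /\
  (forall n, schur (conj_part la) n =
     \sum_(al <- pts (weight la)) T al *: schur_sum (chain_fg (eword al)) n).
Proof.
move=> hT.
have expand (w : intpart -> seq (bool * nat)) mu n :
    (forall nu, (nu == mu)%:R =
       \sum_(al <- pts (weight la)) T al * (chains (w al) nu)%:R) ->
    schur mu n = \sum_(al <- pts (weight la)) T al *: schur_sum (chain_fg (w al)) n.
  move=> h; rewrite -schur_sum_sum -schur_sumU; congr (schur_sum _ n).
  apply/eqP/freeg_eqP => nu; rewrite coeffU mul1r eq_sym h raddf_sum /=.
  by apply: eq_bigr => al _; rewrite coeffZ coeff_chain_fg.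
split=> n; apply: expand => // nu.
under eq_bigr do rewrite eword_flip chains_conj.
by rewrite -hT -(inj_eq (inv_inj conj_partK)) conj_partK.
Qed.

Lemma perp_ideal m :
  (forall a b, pairing m (fun la => (chains (hword b ++ hword a) la)%:R -
                            (chains (eword b ++ hword a) la)%:R) = 0) ->
  forall g, conj_ideal g -> perp m g.
Proof.
move=> h _ [r [a [la [sa ->]]]].
have perp_hh x y : perp m (fun n => schur_sum (chain_fg (hword x)) n *
    (schur_sum (chain_fg (hword y)) n - schur_sum (chain_fg (eword y)) n)).
  exists (-1 *: chain_fg (eword y ++ hword x) + chain_fg (hword y ++ hword x)).
    apply: functional_extensionality_dep => n.
    by rewrite schur_sum_lin !schur_sum_chain_fg_cat scaleN1r [RHS]addrC -mulrBl mulrC.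
  rewrite pairing_coeff_lin mulN1r addrC -pairingB -(h x y).
  by apply: eq_pairing => nu; rewrite !coeff_chain_fg.
(* The second factor is extended from h_y - e_y to all generators of the ideal; next, the multiplier
   is extended from products of the h_k to Schur functions. *)
have perp_hs x mu : perp m (fun n => schur_sum (chain_fg (hword x)) n *
    (schur mu n - schur (conj_part mu) n)).
  have [T /schur_chains [E1 E2]] := delta_chains mu.
  apply: perp_ext (perp_sum (pts (weight mu)) T (perp_hh x)) => n.
  rewrite E1 E2 -sumrB mulr_sumr; apply: eq_bigr => al _.
  by rewrite -scalerBr scalerAr.
have perp_ss nu mu : perp m (fun n => schur nu n *
    (schur mu n - schur (conj_part mu) n)).
  have [T /schur_chains [E1 _]] := delta_chains nu.
  apply: perp_ext (perp_sum (pts (weight nu)) T (fun x => perp_hs x mu)) => n.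
  by rewrite E1 mulr_suml; apply: eq_bigr => al _; rewrite scalerAl.
pose G (i : 'I_r) n := a i n * (schur (la i) n - schur (conj_part (la i)) n).
suff perp_G i : perp m (G i).
  apply: perp_ext (perp_sum (index_enum 'I_r) (fun=> 1) perp_G) => n.
  by apply: eq_bigr => i _; rewrite scale1r.
(* An arbitrary multiplier is a combination of Schur functions. *)
rewrite /G; have [A ->] := symfun_schur_sumP (sa i).
have := perp_sum (dom A) (fun nu => coeff nu A) (fun nu => perp_ss nu (la i)).
apply: perp_ext => n.
by rewrite mulr_suml; apply: eq_bigr => nu _; rewrite scalerAl.
Qed.

Lemma doubly_symmetricP m : doubly_symmetric (schur_sum m) <->
  (forall a b, pairing m (fun la => (chains (hword b ++ hword a) la)%:R -
                            (chains (eword b ++ hword a) la)%:R) = 0).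
Proof.
split=> [[m' [/schur_sum_inj <-]] /hook_schur_sumP //|h].
by exists m; split=> //; apply/hook_schur_sumP.
Qed.

Lemma doubly_symmetric_orthogonal m : doubly_symmetric (schur_sum m) <->
  (forall g, conj_ideal g -> hall (schur_sum m) g = 0).
Proof.
split=> [/doubly_symmetricP/perp_ideal h g /h [m' -> perp_m']|h].
  by rewrite hall_schur_sum.
apply/doubly_symmetricP => a b.
have := h _ (conj_ideal_chains a b).
rewrite (_ : (fun n => _) =
  schur_sum (-1 *: chain_fg (eword b ++ hword a) + chain_fg (hword b ++ hword a))).
  rewrite hall_schur_sum pairing_coeff_lin mulN1r addrC -pairingB => <-.
  by apply: eq_pairing => nu; rewrite !coeff_chain_fg.
by apply: functional_extensionality_dep => n; rewrite schur_sum_lin scaleN1r addrC.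
Qed.

Lemma doubly_symmetric_symfun f : doubly_symmetric f -> symfun f.
Proof. by case=> m [-> _]; apply: symfun_schur_sum. Qed.

(** Below the weight bound [D] the ideal elements form a subspace of a finite-dimensional space, on
    which [m] is projected. The remainder is orthogonal only to ideal elements of weight at most
    [D], so double symmetry must still be checked against all h_a (h_b - e_b). *)
Lemma orthogonal_ideal_split m : exists m1 m2,
  [/\ m = m1 + m2, doubly_symmetric (schur_sum m1) & conj_ideal (schur_sum m2)].
Proof.
pose D := (\sum_(la <- dom m) weight la)%N; pose s := ptsle D.
have us : uniq s := uniq_ptsle D.
have dom_s : {subset dom m <= s}.
  by move=> la la_m; rewrite mem_ptsle /D (bigD1_seq la) ?uniq_dom //= leq_addr.
pose c (v : 'rV[rat]_(size s)) la :=
  if insub (index la s) is Some j then v 0 j else 0.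
have c_nth v (j : 'I_(size s)) : c v (nth part0 s j) = v 0 j.
  by rewrite /c index_uniq // valK.
pose M v := fg_of s (c v).
have coeff_M v la : coeff la (M v) = c v la.
  rewrite coeff_fg_of //; case: ifPn => //.
  by rewrite -index_mem /c => h; rewrite insubN.
have M_lin a u v : M (a *: u + v) = a *: M u + M v.
  apply/eqP/freeg_eqP => la; rewrite coeffD coeffZ !coeff_M /c.
  by case: insub => [j|]; rewrite ?mxE // mulr0 addr0.
pose vec (m' : {freeg intpart / rat}) : 'rV[rat]_(size s) :=
  \row_j coeff (nth part0 s j) m'.
have M_vec m' : {subset dom m' <= s} -> M (vec m') = m'.
  move=> sub; apply/eqP/freeg_eqP => la; rewrite coeff_M /c.
  case: insubP => [j _ eq_j|]; last first.
    by rewrite index_mem => h; rewrite coeff_outdom //; apply: contra h; apply: sub.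
  by rewrite mxE eq_j nth_index // -index_mem -eq_j ltn_ord.
have [||u [w [eq_v Jw orth]]] := @orthogonal_decomposition _
    (fun v => conj_ideal (schur_sum (M v))) _ _ (vec m).
- rewrite (_ : M 0 = 0).
    by apply: conj_ideal_ext conj_ideal0 => n; rewrite /schur_sum dom0 big_nil.
  apply/eqP/freeg_eqP => la; rewrite coeff0 coeff_M /c.
  by case: insub => // j; rewrite mxE.
- move=> a u v Ju Jv; rewrite M_lin.
  apply: conj_ideal_ext (conj_idealD (conj_idealZ a Ju) Jv) => n.
  by rewrite schur_sum_lin.
exists (M u), (M w); split=> //.
  by rewrite -[LHS](M_vec _ dom_s) eq_v -[u]scale1r M_lin !scale1r.
apply/doubly_symmetricP => a b.
pose m' := -1 *: chain_fg (eword b ++ hword a) + chain_fg (hword b ++ hword a).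
have coeff_m' la : coeff la m' = (chains (hword b ++ hword a) la)%:R -
                            (chains (eword b ++ hword a) la)%:R.
  by rewrite coeffD coeffZ !coeff_chain_fg mulN1r addrC.
transitivity (pairing (M u) (fun la => coeff la m')).
  by apply: eq_pairing => la; rewrite coeff_m'.
rewrite pairing_fg_of //.
have wsize_e : wsize (eword b ++ hword a) = wsize (hword b ++ hword a).
  by rewrite /wsize !map_cat -!map_comp.
(* The tested element is homogeneous: it either lies wholly inside the truncation, where
   orthogonality is known, or meets none of the partitions in [s]. *)
have [le_D|lt_D] := leqP (wsize (hword b ++ hword a)) D; last first.
  rewrite big_seq big1 // => la; rewrite mem_ptsle coeff_m' => le_la.
  by rewrite !chains_weight ?wsize_e ?subrr ?mulr0 //; lia.
have sub' : {subset dom m' <= s}.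
  move=> la; rewrite mem_dom coeff_m' mem_ptsle => nz; rewrite leqNgt.
  apply: contra nz => lt_la; rewrite !chains_weight ?wsize_e ?subrr //; lia.
have Jm' : conj_ideal (schur_sum (M (vec m'))).
  rewrite M_vec //; apply: conj_ideal_ext (conj_ideal_chains a b) => n.
  by rewrite schur_sum_lin scaleN1r addrC.
have := congr1 (fun A : 'M_1 => A 0 0) (orth _ Jm'); rewrite !mxE /= => orth0.
rewrite -[RHS]orth0.
rewrite (big_nth part0) big_mkord; apply: eq_bigr => j _.
by rewrite c_nth !mxE.
Qed.

Lemma hall_definite m : hall (schur_sum m) (schur_sum m) = 0 -> m = 0.
Proof.
rewrite hall_schur_sum /pairing => /eqP.
rewrite Num.Theory.psumr_eq0 => [/allP h|la _]; last first.
  by rewrite -expr2 Num.Theory.sqr_ge0.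
apply/eqP/freeg_eqP => la; rewrite coeff0.
have [/h|/coeff_outdom //] := boolP (la \in dom m).
by rewrite mulf_eq0 orbb => /eqP.
Qed.

Theorem theorem2p4 :
  (* D is the orthogonal complement of I in S *)
  (forall f : polyfam,
     doubly_symmetric f <->
     symfun f /\ forall g : polyfam, conj_ideal g -> hall f g = 0) /\
  (* S = D + I *)
  (forall f : polyfam,
     symfun f <->
     exists d i : polyfam,
       [/\ doubly_symmetric d, conj_ideal i & f = fun n => d n + i n]) /\
  (* the sum is direct *)
  (forall f : polyfam,
     doubly_symmetric f -> conj_ideal f -> f = fun n => 0).
Proof.
split; [|split].
- move=> f; split=> [ds_f|[/symfun_schur_sumP [m ->]]].
    split; first exact: doubly_symmetric_symfun.
    by case: (ds_f) => m [eq_f _]; move: ds_f; rewrite eq_f => /doubly_symmetric_orthogonal.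
  by move/doubly_symmetric_orthogonal.
- move=> f; split=> [/symfun_schur_sumP [m ->]|[d [i [ds_d I_i ->]]]].
    have [m1 [m2 [-> ds1 I2]]] := orthogonal_ideal_split m.
    exists (schur_sum m1), (schur_sum m2); split=> //.
    apply: functional_extensionality_dep => n.
    by rewrite -[m1]scale1r schur_sum_lin !scale1r.
  by apply: symfunD; [apply: doubly_symmetric_symfun | apply: conj_ideal_symfun].
(* An element of both spaces is orthogonal to itself. *)
move=> f ds_f I_f; case: (ds_f) => m [eq_f _].
move: ds_f I_f; rewrite eq_f => /doubly_symmetric_orthogonal orth /orth.
move=> /hall_definite ->; apply: functional_extensionality_dep => n.
by rewrite /schur_sum dom0 big_nil.
Qed.
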